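(* Let $X$ and $Y$ be locally pseudocompact spaces, neither of which is pseudocompact. If the partially ordered sets $(\mathscr{U}(X),\leq)$ and $(\mathscr{U}(Y),\leq)$ are order-isomorphic, then $\mathrm{cl}_{\beta X}(\beta X\setminus\upsilon X)$ and $\mathrm{cl}_{\beta Y}(\beta Y\setminus\upsilon Y)$ are homeomorphic.
   Context: All spaces are completely regular Hausdorff. $\beta X$ is the Stone–Čech compactification and $\upsilon X\subseteq\beta X$ the Hewitt realcompactification of $X$. An extension of $X$ is a space containing $X$ as a dense subspace; its remainder is $Y\setminus X$. Extensions are identified up to homeomorphisms fixing $X$ pointwise, and $Y\leq Y'$ means there is a continuous map $Y'\to Y$ fixing $X$ pointwise. A space is pseudocompact if every continuous real-valued function on it is bounded; $X$ is locally pseudocompact if every point has an open neighborhood with pseudocompact closure. $\mathscr{U}(X)$ denotes the set of all pseudocompact extensions of $X$ with compact remainder, partially ordered by $\leq$. An order-isomorphism is a bijection $f$ with $f$ and $f^{-1}$ both order-preserving. *)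

(* Defs.v *)
From Stdlib Require Import Reals List Classical.
Open Scope R_scope.

Record space := Space { pt :> Type; op : (pt -> Prop) -> Prop }.
Arguments op {s} _.

Definition is_topology (S : space) : Prop :=
  op (fun _ : S => True) /\
  (forall U V : S -> Prop, op U -> op V -> op (fun x => U x /\ V x)) /\
  (forall F : (S -> Prop) -> Prop, (forall U, F U -> op U) ->
     op (fun x => exists U, F U /\ U x)).

Definition continuous {S T : space} (f : S -> T) : Prop :=
  forall V : T -> Prop, op V -> op (fun x => V (f x)).

Definition closed {S : space} (C : S -> Prop) : Prop := op (fun x => ~ C x).

Definition closure {S : space} (A : S -> Prop) : S -> Prop :=
  fun x => forall U : S -> Prop, op U -> U x -> exists y, U y /\ A y.

Definition RealLine : space :=
  Space R (fun U => forall x, U x -> exists eps, 0 < eps /\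
                      forall y, Rabs (y - x) < eps -> U y).

Definition subspace (S : space) (A : S -> Prop) : space :=
  Space {x : S | A x}
    (fun V => exists U : S -> Prop, op U /\
               forall y : {x : S | A x}, V y <-> U (proj1_sig y)).

Definition Hausdorff (S : space) : Prop :=
  forall x y : S, x <> y -> exists U V : S -> Prop,
    op U /\ op V /\ U x /\ V y /\ forall z, ~ (U z /\ V z).

Definition completely_regular (S : space) : Prop :=
  forall (C : S -> Prop) (x : S), closed C -> ~ C x ->
    exists f : S -> RealLine, continuous f /\ f x = 0 /\
      (forall y, C y -> f y = 1) /\ (forall y, 0 <= f y <= 1).

Definition Tychonoff (S : space) : Prop :=
  is_topology S /\ Hausdorff S /\ completely_regular S.

Definition compact (S : space) : Prop :=
  forall F : (S -> Prop) -> Prop, (forall U, F U -> op U) ->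
    (forall x, exists U, F U /\ U x) ->
    exists l : list (S -> Prop), (forall U, In U l -> F U) /\
      forall x, exists U, In U l /\ U x.

Definition pseudocompact (S : space) : Prop :=
  forall f : S -> RealLine, continuous f -> exists M, forall x, Rabs (f x) <= M.

Definition locally_pseudocompact (S : space) : Prop :=
  forall x : S, exists U : S -> Prop, op U /\ U x /\
    pseudocompact (subspace S (closure U)).

Definition homeomorphic (S T : space) : Prop :=
  exists (f : S -> T) (g : T -> S), continuous f /\ continuous g /\
    (forall x, g (f x) = x) /\ (forall y, f (g y) = y).

Definition embedding {S T : space} (e : S -> T) : Prop :=
  continuous e /\ (forall x y, e x = e y -> x = y) /\
  (forall U : S -> Prop, op U -> exists V : T -> Prop, op V /\
     forall x, U x <-> V (e x)).

Record extension (X : space) := Ext { ext_sp : space; ext_map : X -> ext_sp }.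
Arguments ext_sp {X} _.
Arguments ext_map {X} _ _.

Definition image_of {X : space} (E : extension X) : ext_sp E -> Prop :=
  fun y => exists x, ext_map E x = y.

Definition is_extension {X : space} (E : extension X) : Prop :=
  Tychonoff (ext_sp E) /\ embedding (ext_map E) /\
  (forall y, closure (image_of E) y).

Definition remainder {X : space} (E : extension X) : ext_sp E -> Prop :=
  fun y => ~ image_of E y.

Definition in_U (X : space) (E : extension X) : Prop :=
  is_extension E /\ pseudocompact (ext_sp E) /\
  compact (subspace (ext_sp E) (remainder E)).

Definition ext_le {X : space} (E E' : extension X) : Prop :=
  exists g : ext_sp E' -> ext_sp E, continuous g /\
    forall x, g (ext_map E' x) = ext_map E x.

Definition ext_equiv {X : space} (E E' : extension X) : Prop :=
  exists (h : ext_sp E -> ext_sp E') (k : ext_sp E' -> ext_sp E),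
    continuous h /\ continuous k /\ (forall y, k (h y) = y) /\
    (forall y, h (k y) = y) /\ (forall x, h (ext_map E x) = ext_map E' x).

(* (U(X), <=) and (U(Y), <=) are order-isomorphic: a relation R between
   representatives inducing a bijection of identification classes which
   preserves and reflects <=. *)
Definition U_order_isomorphic (X Y : space) : Prop :=
  exists R : extension X -> extension Y -> Prop,
    (forall A B, R A B -> in_U X A /\ in_U Y B) /\
    (forall A, in_U X A -> exists B, R A B) /\
    (forall B, in_U Y B -> exists A, R A B) /\
    (forall A A' B B', R A B -> R A' B' -> (ext_equiv A A' <-> ext_equiv B B')) /\
    (forall A A' B B', R A B -> R A' B' -> (ext_le A A' <-> ext_le B B')).

Definition is_stone_cech {X : space} (K : extension X) : Prop :=
  is_extension K /\ compact (ext_sp K) /\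
  forall (Z : space) (f : X -> Z), is_topology Z -> Hausdorff Z -> compact Z ->
    continuous f -> exists g : ext_sp K -> Z, continuous g /\
      forall x, g (ext_map K x) = f x.

(* the Hewitt realcompactification, as a subset of K = beta X:
   p is in upsilon X iff every f in C(X) extends continuously to X u {p} *)
Definition hewitt {X : space} (K : extension X) : ext_sp K -> Prop :=
  fun p => forall f : X -> RealLine, continuous f ->
    exists g : subspace (ext_sp K) (fun q => q = p \/ image_of K q) -> RealLine,
      continuous g /\
      forall x (h : ext_map K x = p \/ image_of K (ext_map K x)),
        g (exist _ (ext_map K x) h) = f x.

Definition cl_rem_hewitt {X : space} (K : extension X) : ext_sp K -> Prop :=
  closure (fun p => ~ hewitt K p).

(* Main.v *)
From Stdlib Require Import Reals List Classical.
From Stdlib Require Import ClassicalEpsilon FunctionalExtensionality PropExtensionality Lra.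
Require Import Defs.
Import ListNotations.

(** Let [K] be the Stone–Čech compactification of [X] and [H0] the closure of
    [K \ upsilon X].  Every extension [E] of [X] induces a partial equivalence
    relation on [K], whose classes are the fibres of the canonical partial map
    from [K] onto [E], and [E <= E'] means that the relation of [E'] is contained
    in that of [E].  For [E] in [U(X)] the domain contains [H0], which misses [X]
    by local pseudocompactness; conversely, every relation obtained from a closed
    [H] with [H0 <= H <= K \ X] by shrinking one closed subset [C] of [H] to a
    point comes from an element of [U(X)].

    The coatoms of [U(X)] therefore either identify two points of [H0] or add a
    point of [K \ X] to [H0], and the order distinguishes the two kinds.  An
    order-isomorphism thus gives a bijection between the two-point subsets of
    [H0] for [X] and for [Y]; it preserves triangles, hence comes from a bijection
    of the points.  A nonempty subset [C] of [H0] is closed iff some element of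
    [U(X)] identifies exactly the pairs of points of [C], so that bijection is a
    homeomorphism. *)

(** * Elementary topology of spaces and subspaces *)

Lemma op_ext {S : space} (U V : S -> Prop) :
  (forall x, U x <-> V x) -> op U -> op V.
Proof.
  intros H HU. replace V with U; auto.
  extensionality x. apply propositional_extensionality; auto.
Qed.

Lemma op_local {S : space} (U : S -> Prop) : is_topology S ->
  (forall x, U x -> exists V, op V /\ V x /\ forall y, V y -> U y) -> op U.
Proof.
  intros [_ [_ HU]] H.
  apply (op_ext (fun x => exists V, (op V /\ forall y, V y -> U y) /\ V x)).
  - intros x; split.
    + intros [V [[_ H1] H2]]; auto.
    + intros Hx; destruct (H x Hx) as [V [H1 [H2 H3]]]; exists V; auto.
  - apply HU. intros V [H1 _]; exact H1.
Qed.

Lemma op_and {S : space} (U V : S -> Prop) :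
  is_topology S -> op U -> op V -> op (fun x => U x /\ V x).
Proof. intros [_ [H _]]; apply H. Qed.

Lemma op_or {S : space} (U V : S -> Prop) :
  is_topology S -> op U -> op V -> op (fun x => U x \/ V x).
Proof.
  intros HS HU HV. apply op_local; [exact HS|].
  intros x [H|H]; [exists U | exists V]; auto.
Qed.

Lemma closed_or {S : space} (A B : S -> Prop) :
  is_topology S -> closed A -> closed B -> closed (fun x => A x \/ B x).
Proof.
  intros HS HA HB. unfold closed.
  apply (op_ext (fun x => ~ A x /\ ~ B x)); [intros x; tauto|].
  apply op_and; auto.
Qed.

Lemma closed_point {S : space} (x : S) :
  is_topology S -> Hausdorff S -> closed (fun y => y = x).
Proof.
  intros HS HH. apply op_local; [exact HS|].
  intros y Hy. destruct (HH y x Hy) as [U [V [HU [HV [Uy [Vx D]]]]]].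
  exists U; repeat split; auto. intros z Uz E; subst. apply (D x); auto.
Qed.

Lemma closed_pair {S : space} (x y : S) :
  is_topology S -> Hausdorff S -> closed (fun z => z = x \/ z = y).
Proof. intros; apply closed_or; auto; apply closed_point; auto. Qed.

Lemma closure_closed {S : space} (A : S -> Prop) :
  is_topology S -> closed (closure A).
Proof.
  intros HS. apply op_local; [exact HS|].
  intros x Hx. unfold closure in Hx. apply not_all_ex_not in Hx.
  destruct Hx as [U HU]. exists U.
  apply imply_to_and in HU. destruct HU as [HU H]. apply imply_to_and in H.
  destruct H as [Ux H]. repeat split; auto.
Qed.

Lemma subset_closure {S : space} (A : S -> Prop) x : A x -> closure A x.
Proof. intros Ax U _ Ux; exists x; auto. Qed.

Lemma sig_ext {A : Type} {P : A -> Prop} (x y : {a : A | P a}) :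
  proj1_sig x = proj1_sig y -> x = y.
Proof.
  destruct x as [x px], y as [y py]; simpl; intros; subst.
  f_equal. apply proof_irrelevance.
Qed.

Lemma subspace_topology (S : space) (A : S -> Prop) :
  is_topology S -> is_topology (subspace S A).
Proof.
  intros HS. split; [|split].
  - exists (fun _ => True). split; [apply HS | tauto].
  - intros U V [U' [HU EU]] [V' [HV EV]].
    exists (fun x => U' x /\ V' x). split; [apply op_and; auto|].
    intros y; rewrite EU, EV; tauto.
  - intros F HF.
    exists (fun x => exists W, (op W /\ exists U, F U /\
                      forall y : subspace S A, U y <-> W (proj1_sig y)) /\ W x).
    split.
    + apply HS. intros W [H _]; exact H.
    + intros y; split.
      * intros [U [FU Uy]]. destruct (HF U FU) as [W [HW E]].
        exists W. split; [split; [exact HW|exists U; auto]|]. apply E; exact Uy.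
      * intros [W [[_ [U [FU E]]] Wy]]. exists U. split; auto. apply E; exact Wy.
Qed.

Lemma subspace_Hausdorff (S : space) (A : S -> Prop) :
  Hausdorff S -> Hausdorff (subspace S A).
Proof.
  intros H x y Hxy.
  assert (N : proj1_sig x <> proj1_sig y) by (intro E; apply Hxy, sig_ext, E).
  destruct (H _ _ N) as [U [V [HU [HV [Ux [Vy D]]]]]].
  exists (fun z => U (proj1_sig z)), (fun z => V (proj1_sig z)).
  split; [exists U; split; auto; tauto|].
  split; [exists V; split; auto; tauto|].
  repeat split; auto.
Qed.

Lemma closed_subspace_image (S : space) (A : S -> Prop) (D : subspace S A -> Prop) :
  is_topology S -> closed A -> closed D ->
  closed (fun q => exists h : A q, D (exist _ q h)).
Proof.
  intros HS HA [U [HU E]].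
  unfold closed. apply (op_ext (fun q => ~ A q \/ U q)).
  - intros q; split.
    + intros [H|H] [h Dh]; [exact (H h)|]. apply (E (exist _ q h)) in H. auto.
    + intros H. destruct (classic (A q)) as [h|h]; auto.
      right. apply (E (exist _ q h)). intro Dh. apply H. exists h; exact Dh.
  - apply op_or; auto.
Qed.

(** * Compactness *)

(** Compactness of a subset, phrased with open sets of the ambient space. The predicate [P] records
    what each chosen neighbourhood provides, so that the finite subcover keeps it. *)
Definition cover_compact {S : space} (A : S -> Prop) : Prop :=
  forall P : (S -> Prop) -> Prop,
    (forall p, A p -> exists U, op U /\ U p /\ P U) ->
    exists l, (forall U, In U l -> op U /\ P U) /\
      forall p, A p -> exists U, In U l /\ U p.

Lemma list_subset {A : Type} (P : A -> Prop) (l : list A) :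
  exists l', forall x, In x l' <-> In x l /\ P x.
Proof.
  induction l as [|a l [l' IH]].
  - exists []; simpl; tauto.
  - destruct (classic (P a)) as [H|H].
    + exists (a :: l'). intros x; simpl. rewrite IH.
      split; [intros [E|E]; subst; tauto | tauto].
    + exists l'. intros x; simpl. rewrite IH.
      split; [tauto | intros [[E|E] Px]; subst; tauto].
Qed.

Lemma closed_cover_compact {S : space} (A : S -> Prop) :
  is_topology S -> compact S -> closed A -> cover_compact A.
Proof.
  intros HS HC HA P HP.
  destruct (HC (fun U => op U /\ (P U \/ forall p, U p -> ~ A p))) as [l [Hl Hcov]].
  - intros U [H _]; exact H.
  - intros x. destruct (classic (A x)) as [Ax|Ax].
    + destruct (HP x Ax) as [U [HU [Ux PU]]]. exists U; auto.
    + exists (fun y => ~ A y). repeat split; auto.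
  - destruct (list_subset P l) as [l' Hl'].
    exists l'. split.
    + intros U HU. apply Hl' in HU. destruct HU as [HU PU]. split; auto. apply Hl; auto.
    + intros p Ap. destruct (Hcov p) as [U [HU Up]]. exists U. split; auto.
      apply Hl'. split; auto. destruct (Hl U HU) as [_ [H|H]]; auto.
      exfalso; exact (H p Up Ap).
Qed.

Lemma space_cover_compact {S : space} :
  is_topology S -> compact S -> cover_compact (fun _ : S => True).
Proof.
  intros HS HC. apply closed_cover_compact; auto.
  apply op_local; [exact HS|]. intros x H; exfalso; auto.
Qed.

Lemma list_lift {A B : Type} (Q : A -> B -> Prop) (l : list A) :
  (forall x, In x l -> exists y, Q x y) ->
  exists l', (forall y, In y l' -> exists x, In x l /\ Q x y) /\
             (forall x, In x l -> exists y, In y l' /\ Q x y).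
Proof.
  induction l as [|a l IH]; intros H.
  - exists []. split; intros ? [].
  - destruct IH as [l' [H1 H2]]; [intros; apply H; right; auto|].
    destruct (H a (or_introl eq_refl)) as [b Hb].
    exists (b :: l'). split.
    + intros y [E|E]; [subst; exists a; split; [left|]; auto|].
      destruct (H1 y E) as [x [Hx Q']]. exists x; split; [right|]; auto.
    + intros x [E|E]; [subst; exists b; split; [left|]; auto|].
      destruct (H2 x E) as [y [Hy Q']]. exists y; split; [right|]; auto.
Qed.

Lemma compact_subspace_cover {S : space} (A : S -> Prop) :
  compact (subspace S A) -> cover_compact A.
Proof.
  intros HC P HP.
  destruct (HC (fun V => exists U : S -> Prop, (op U /\ P U) /\
                  forall y : subspace S A, V y <-> U (proj1_sig y))) as [l [Hl Hcov]].
  - intros V [U [[HU _] E]]. exists U; auto.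
  - intros [x Ax]. destruct (HP x Ax) as [U [HU [Ux PU]]].
    exists (fun y => U (proj1_sig y)). split; auto. exists U; split; auto; tauto.
  - destruct (list_lift _ l Hl) as [l' [H1 H2]].
    exists l'. split.
    + intros U HU. destruct (H1 U HU) as [V [_ [H _]]]; exact H.
    + intros p Ap. destruct (Hcov (exist _ p Ap)) as [V [HV Vp]].
      destruct (H2 V HV) as [U [HU [_ E]]]. exists U; split; auto.
      apply (E (exist _ p Ap)); exact Vp.
Qed.

Lemma cover_compact_subspace {S : space} (A : S -> Prop) :
  cover_compact A -> compact (subspace S A).
Proof.
  intros HC F HF Hcov.
  destruct (HC (fun U : S -> Prop => exists V, F V /\
                  forall y : subspace S A, V y <-> U (proj1_sig y))) as [l [Hl Hl']].
  - intros p Ap. destruct (Hcov (exist _ p Ap)) as [V [FV Vp]].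
    destruct (HF V FV) as [U [HU E]]. exists U. repeat split; auto.
    + apply (E (exist _ p Ap)); exact Vp.
    + exists V; auto.
  - destruct (list_lift (fun U V => F V /\
                  forall y : subspace S A, V y <-> U (proj1_sig y)) l) as [l' [H1 H2]].
    + intros U HU. apply Hl; auto.
    + exists l'. split.
      * intros V HV. destruct (H1 V HV) as [U [_ [H _]]]; exact H.
      * intros [p Ap]. destruct (Hl' p Ap) as [U [HU Up]].
        destruct (H2 U HU) as [V [HV [_ E]]]. exists V; split; auto. apply E; exact Up.
Qed.

(** Finitely many of the [U] cover [A]; their union and the intersection of the corresponding [V]
    work together. *)
Lemma tube {S T : space} (A : S -> Prop) (y : T) (D : S -> T -> Prop) :
  is_topology S -> is_topology T -> cover_compact A ->
  (forall p, A p -> exists U V, op U /\ U p /\ op V /\ V y /\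
     forall s t, U s -> V t -> ~ D s t) ->
  exists U V, op U /\ (forall p, A p -> U p) /\ op V /\ V y /\
     forall s t, U s -> V t -> ~ D s t.
Proof.
  intros HS HT HC H.
  destruct (HC (fun U => exists V, op V /\ V y /\
     forall s t, U s -> V t -> ~ D s t)) as [l [Hl Hcov]].
  { intros p Ap. destruct (H p Ap) as [U [V [H1 [H2 H3]]]]. exists U.
    repeat split; auto. exists V; auto. }
  assert (L : exists U V, op U /\ (forall p, (exists W, In W l /\ W p) -> U p) /\
     op V /\ V y /\ forall s t, U s -> V t -> ~ D s t).
  { clear Hcov. induction l as [|W l IH].
    - exists (fun _ => False), (fun _ => True). repeat split; auto.
      + apply op_local; [exact HS|]. intros x [].
      + intros p [W [[] _]].
      + apply HT.
    - destruct IH as [U [V [HU [cU [HV [Vy HD]]]]]].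
      { intros U HU; apply Hl; right; auto. }
      destruct (Hl W (or_introl eq_refl)) as [HW [V' [HV' [Vy' HD']]]].
      exists (fun s => W s \/ U s), (fun t => V' t /\ V t). repeat split; auto.
      + apply op_or; auto.
      + intros p [W' [[E|E] Wp]]; [subst; left; auto|right].
        apply cU. exists W'; auto.
      + apply op_and; auto.
      + intros s t [Ws|Us] [V't Vt]; eauto. }
  destruct L as [U [V [HU [cU H']]]]. exists U, V. split; auto.
Qed.

Lemma cover_compact_closed {S : space} (A : S -> Prop) :
  is_topology S -> Hausdorff S -> cover_compact A -> closed A.
Proof.
  intros HS HH HC. apply op_local; [exact HS|]. intros x Hx.
  destruct (tube A x (fun s t => s = t)) as [U [V [HU [cU [HV [Vx HD]]]]]]; auto.
  - intros p Ap. assert (N : p <> x) by (intro; subst; auto).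
    destruct (HH _ _ N) as [U [V [HU [HV [Up [Vx D]]]]]].
    exists U, V; repeat split; auto. intros s t Us Vt E; subst. apply (D t); auto.
  - exists V; repeat split; auto. intros z Vz Az. apply (HD z z); auto.
Qed.

(** * Real-valued functions *)

Lemma ball_open (a r : R) : @op RealLine (fun z => Rabs (z - a) < r).
Proof.
  intros x Hx. exists (r - Rabs (x - a)). split; [lra|].
  intros y Hy. replace (y - a) with ((y - x) + (x - a)) by ring.
  pose proof (Rabs_triang (y - x) (x - a)). lra.
Qed.

Lemma RealLine_topology : is_topology RealLine.
Proof.
  split; [|split].
  - intros x _. exists 1. split; [lra|auto].
  - intros U V HU HV x [Ux Vx].
    destruct (HU x Ux) as [e [He H1]], (HV x Vx) as [d [Hd H2]].
    exists (Rmin e d). split; [apply Rmin_glb_lt; auto|].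
    intros y Hy. pose proof (Rmin_l e d). pose proof (Rmin_r e d).
    split; [apply H1 | apply H2]; lra.
  - intros F HF x [U [FU Ux]]. destruct (HF U FU x Ux) as [e [He H]].
    exists e. split; auto. intros y Hy. exists U; auto.
Qed.

Lemma RealLine_Hausdorff : Hausdorff RealLine.
Proof.
  intros x y Hxy.
  assert (P : 0 < Rabs (x - y)) by (apply Rabs_pos_lt; lra).
  exists (fun z => Rabs (z - x) < Rabs (x - y) / 2),
         (fun z => Rabs (z - y) < Rabs (x - y) / 2).
  split; [apply ball_open|]. split; [apply ball_open|].
  replace (x - x) with 0 by ring. replace (y - y) with 0 by ring.
  rewrite Rabs_R0. split; [lra|]. split; [lra|].
  intros z [H1 H2]. rewrite Rabs_minus_sym in H1.
  pose proof (Rabs_triang (x - z) (z - y)).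
  replace (x - z + (z - y)) with (x - y) in H by ring. lra.
Qed.

Lemma continuous_nbhd {S : space} (f : S -> RealLine) x eps :
  continuous f -> 0 < eps ->
  exists U, op U /\ U x /\ forall y, U y -> Rabs (f y - f x) < eps.
Proof.
  intros Hf He. exists (fun y => Rabs (f y - f x) < eps).
  split; [exact (Hf _ (ball_open (f x) eps))|]. split; auto.
  replace (f x - f x) with 0 by ring. rewrite Rabs_R0; auto.
Qed.

Lemma continuous_intro {S : space} (f : S -> RealLine) : is_topology S ->
  (forall x eps, 0 < eps ->
     exists U, op U /\ U x /\ forall y, U y -> Rabs (f y - f x) < eps) ->
  continuous f.
Proof.
  intros HS H V HV. apply op_local; [exact HS|]. intros x Vx.
  destruct (HV (f x) Vx) as [e [He HeV]].
  destruct (H x e He) as [U [HU [Ux HUV]]]. exists U; repeat split; auto.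
Qed.

Lemma continuous_lipschitz {S : space} (f : S -> RealLine) (phi : R -> R) (L : R) :
  is_topology S -> 0 < L ->
  (forall u v, Rabs (phi u - phi v) <= L * Rabs (u - v)) ->
  continuous f -> @continuous S RealLine (fun x => phi (f x)).
Proof.
  intros HS HL Hphi Hf. apply continuous_intro; [exact HS|]. intros x eps He.
  destruct (continuous_nbhd f x (eps / L) Hf) as [U [HU [Ux H]]].
  { apply Rdiv_lt_0_compat; auto. }
  exists U; repeat split; auto. intros y Uy.
  eapply Rle_lt_trans; [apply Hphi|].
  replace eps with (L * (eps / L)) by (field; lra).
  apply Rmult_lt_compat_l; auto.
Qed.

Lemma continuous_plus {S : space} (f g : S -> RealLine) : is_topology S ->
  continuous f -> continuous g -> @continuous S RealLine (fun x => f x + g x).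
Proof.
  intros HS Hf Hg. apply continuous_intro; [exact HS|]. intros x eps He.
  destruct (continuous_nbhd f x (eps / 2) Hf) as [U [HU [Ux H1]]]; [lra|].
  destruct (continuous_nbhd g x (eps / 2) Hg) as [V [HV [Vx H2]]]; [lra|].
  exists (fun y => U y /\ V y). split; [apply op_and; auto|]. split; auto.
  intros y [Uy Vy]. specialize (H1 y Uy). specialize (H2 y Vy).
  replace (f y + g y - (f x + g x)) with ((f y - f x) + (g y - g x)) by ring.
  pose proof (Rabs_triang (f y - f x) (g y - g x)). lra.
Qed.

Lemma continuous_mult {S : space} (f g : S -> RealLine) : is_topology S ->
  (forall x, Rabs (g x) <= 1) ->
  continuous f -> continuous g -> @continuous S RealLine (fun x => f x * g x).
Proof.
  intros HS Hg1 Hf Hg. apply continuous_intro; [exact HS|]. intros x eps He.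
  pose proof (Rabs_pos (f x)) as P.
  destruct (continuous_nbhd f x (eps / 2) Hf) as [U [HU [Ux H1]]]; [lra|].
  (* Adding 1 keeps the denominator positive when [f x = 0]. *)
  destruct (continuous_nbhd g x (eps / 2 / (Rabs (f x) + 1)) Hg) as [V [HV [Vx H2]]].
  { apply Rdiv_lt_0_compat; lra. }
  exists (fun y => U y /\ V y). split; [apply op_and; auto|]. split; auto.
  intros y [Uy Vy]. specialize (H1 y Uy). specialize (H2 y Vy). specialize (Hg1 y).
  replace (f y * g y - f x * g x)
    with ((f y - f x) * g y + f x * (g y - g x)) by ring.
  eapply Rle_lt_trans; [apply Rabs_triang|]. rewrite !Rabs_mult.
  pose proof (Rabs_pos (f y - f x)). pose proof (Rabs_pos (g y - g x)).
  assert (A1 : Rabs (f y - f x) * Rabs (g y) <= Rabs (f y - f x) * 1)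
    by (apply Rmult_le_compat_l; auto).
  assert (A2 : Rabs (f x) * Rabs (g y - g x) <=
               (Rabs (f x) + 1) * (eps / 2 / (Rabs (f x) + 1))).
  { apply Rmult_le_compat; lra. }
  replace ((Rabs (f x) + 1) * (eps / 2 / (Rabs (f x) + 1))) with (eps / 2) in A2
    by (field; lra).
  lra.
Qed.

Lemma open_lt {S : space} (f : S -> RealLine) a : continuous f -> op (fun x => f x < a).
Proof.
  intros Hf. apply (Hf (fun z => z < a)). intros x Hx. exists (a - x).
  split; [lra|]. intros y Hy. apply Rabs_def2 in Hy. lra.
Qed.

Lemma open_gt {S : space} (f : S -> RealLine) a : continuous f -> op (fun x => a < f x).
Proof.
  intros Hf. apply (Hf (fun z => a < z)). intros x Hx. exists (x - a).
  split; [lra|]. intros y Hy. apply Rabs_def2 in Hy. lra.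
Qed.

(** Heine-Borel by suprema: the supremum [s] of the points up to which finitely many sets suffice
    has a neighbourhood in one further set, so it cannot lie below [b]. *)
Lemma interval_cover_compact (a b : R) :
  @cover_compact RealLine (fun x => a <= x <= b).
Proof.
  intros P HP.
  destruct (Rle_dec a b) as [Hab|Hab].
  2: { exists []. split; [intros ? []|]. intros p Hp; lra. }
  pose (G := fun x => a <= x <= b /\ exists l, (forall U, In U l -> @op RealLine U /\ P U) /\
      forall p, a <= p <= x -> exists U, In U l /\ U p).
  assert (Ga : G a).
  { split; [lra|]. destruct (HP a) as [U [HU [Ua PU]]]; [lra|].
    exists [U]. split.
    - intros V [E|[]]; subst; auto.
    - intros p Hp. exists U. split; [left; auto|]. replace p with a by lra; auto. }
  destruct (completeness G) as [s [Hub Hlub]].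
  { exists b. intros x [Hx _]; lra. }
  { exists a; auto. }
  assert (Has : a <= s) by (apply Hub; auto).
  assert (Hsb : s <= b) by (apply Hlub; intros x [Hx _]; lra).
  destruct (HP s) as [U [HU [Us PU]]]; [lra|].
  destruct (HU s Us) as [e [He HeU]].
  assert (exists x, G x /\ s - e < x) as [x [[Hx [l [Hl Hcov]]] Hxe]].
  { apply NNPP; intro N. assert (s <= s - e); [|lra].
    apply Hlub. intros x Gx. apply Rnot_lt_le. intro; apply N; exists x; auto. }
  assert (Gn : forall z, z <= b -> a <= z -> z < s + e -> G z).
  { intros z Hz1 Hz2 Hz3. split; [lra|]. exists (U :: l). split.
    - intros V [E|E]; subst; auto.
    - intros p Hp. destruct (Rle_dec p x) as [h|h].
      + destruct (Hcov p) as [V [HV Vp]]; [lra|]. exists V; split; [right|]; auto.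
      + exists U. split; [left; auto|]. apply HeU. apply Rabs_def1; lra. }
  assert (Eb : s = b).
  { destruct (Rle_lt_or_eq_dec _ _ Hsb) as [h|h]; auto.
    assert (G (Rmin b (s + e / 2))) as H.
    { apply Gn; unfold Rmin; destruct (Rle_dec b (s + e / 2)); lra. }
    apply Hub in H. unfold Rmin in H. destruct (Rle_dec b (s + e / 2)); lra. }
  destruct (Gn b) as [_ H]; [lra|lra|lra|]. exact H.
Qed.

(** * The Stone–Čech compactification and the points outside the realcompactification *)

Lemma bounded_extends {X : space} (K : extension X) (f : X -> RealLine) B :
  is_stone_cech K -> continuous f -> (forall x, Rabs (f x) <= B) ->
  exists g : ext_sp K -> RealLine, continuous g /\ forall x, g (ext_map K x) = f x.
Proof.
  intros [_ [_ HK]] Hf HB.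
  pose (I := fun x : RealLine => - B <= x <= B).
  assert (HI : forall x, I (f x)).
  { intros x. specialize (HB x). unfold I, Rabs in *. destruct (Rcase_abs (f x)); lra. }
  destruct (HK (subspace RealLine I) (fun x => exist _ (f x) (HI x))) as [g [Hg Eg]].
  - apply subspace_topology, RealLine_topology.
  - apply subspace_Hausdorff, RealLine_Hausdorff.
  - apply cover_compact_subspace, interval_cover_compact.
  - intros V [U [HU E]]. apply (op_ext (fun x => U (f x))).
    + intros x. symmetry. apply (E (exist _ (f x) (HI x))).
    + apply (Hf U HU).
  - exists (fun p => proj1_sig (g p)). split.
    + intros V HV. apply (Hg (fun z => V (proj1_sig z))). exists V; split; auto; tauto.
    + intros x. rewrite Eg; reflexivity.
Qed.

Lemma ext_dense {X : space} (E : extension X) (U : ext_sp E -> Prop) y :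
  is_extension E -> op U -> U y -> exists x, U (ext_map E x).
Proof.
  intros [_ [_ HD]] HU Uy. destruct (HD y U HU Uy) as [z [Uz [x Ex]]].
  exists x. rewrite Ex; exact Uz.
Qed.

(** The working criterion for the Hewitt realcompactification: [p] belongs to it iff every
    continuous [f] is locally bounded at [p]. *)
Definition locally_bounded_at {X : space} (K : extension X) (p : ext_sp K) (f : X -> R) :=
  exists U B, op U /\ U p /\ forall x, U (ext_map K x) -> Rabs (f x) <= B.

Lemma hewitt_locally_bounded {X : space} (K : extension X) p (f : X -> RealLine) :
  hewitt K p -> continuous f -> locally_bounded_at K p f.
Proof.
  intros Hp Hf. destruct (Hp f Hf) as [g [Hg Eg]].
  pose (p' := exist (fun q => q = p \/ image_of K q) p (or_introl eq_refl)).
  destruct (continuous_nbhd g p' 1 Hg) as [V [[U [HU E]] [Vp HV]]]; [lra|].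
  exists U, (Rabs (g p') + 1). split; auto. split; [apply (E p'); exact Vp|].
  intros x Ux.
  assert (h : ext_map K x = p \/ image_of K (ext_map K x)) by (right; exists x; auto).
  specialize (HV (exist _ _ h) (proj2 (E (exist _ _ h)) Ux)). rewrite Eg in HV.
  pose proof (Rabs_triang_inv (f x) (g p')). lra.
Qed.

Definition clamp (B u : R) : R := Rmax (- B) (Rmin B u).

Lemma clamp_lipschitz B u v : Rabs (clamp B u - clamp B v) <= 1 * Rabs (u - v).
Proof.
  unfold clamp, Rmax, Rmin, Rabs.
  destruct (Rle_dec B u), (Rle_dec B v);
  repeat match goal with |- context [Rle_dec ?a ?b] => destruct (Rle_dec a b) end;
  repeat match goal with |- context [Rcase_abs ?a] => destruct (Rcase_abs a) end; lra.
Qed.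

Lemma clamp_id B u : Rabs u <= B -> clamp B u = u.
Proof.
  unfold clamp, Rmax, Rmin, Rabs. destruct (Rcase_abs u); intros;
  destruct (Rle_dec B u);
  repeat match goal with |- context [Rle_dec ?a ?b] => destruct (Rle_dec a b) end; lra.
Qed.

Lemma clamp_bounded B u : 0 <= B -> Rabs (clamp B u) <= B.
Proof.
  unfold clamp, Rmax, Rmin, Rabs. intros; destruct (Rle_dec B u);
  repeat match goal with |- context [Rle_dec ?a ?b] => destruct (Rle_dec a b) end;
  repeat match goal with |- context [Rcase_abs ?a] => destruct (Rcase_abs a) end; lra.
Qed.

(* Near [p] the function agrees with a bounded one, which extends over the
   whole compactification. *)
Lemma locally_bounded_hewitt {X : space} (K : extension X) p :
  is_topology X -> is_stone_cech K ->
  (forall f : X -> RealLine, continuous f -> locally_bounded_at K p f) -> hewitt K p.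
Proof.
  intros HX HK H f Hf.
  destruct (H f Hf) as [U [B0 [HU [Up HB]]]].
  pose (B := Rmax 0 B0).
  assert (PB : 0 <= B) by apply Rmax_l.
  destruct (bounded_extends K (fun x => clamp B (f x)) B HK) as [h [Hh Eh]].
  { apply (continuous_lipschitz f (clamp B) 1); auto; [lra|apply clamp_lipschitz]. }
  { intros x; apply clamp_bounded; auto. }
  assert (Hag : forall x, U (ext_map K x) -> h (ext_map K x) = f x).
  { intros x Ux. rewrite Eh. apply clamp_id.
    pose proof (Rmax_r 0 B0). specialize (HB x Ux). unfold B. lra. }
  destruct HK as [[[HT [HH _]] [[Ce [Ie Oe]] _]] _].
  (* On [X] the extension must be [f] itself, since [h] is known to agree with [f] only over [U];
     off [X] it takes the value of [h]. *)
  assert (HG : forall q : ext_sp K, exists v : R,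
    (forall x, ext_map K x = q -> v = f x) /\ (~ image_of K q -> v = h q)).
  { intros q. destruct (classic (image_of K q)) as [[x Ex]|N].
    - exists (f x). split.
      + intros x' E'. f_equal. apply Ie. congruence.
      + intros N; exfalso; apply N; exists x; auto.
    - exists (h q). split; auto. intros x Ex; exfalso; apply N; exists x; auto. }
  pose (G := fun q => proj1_sig (constructive_indefinite_description _ (HG q))).
  assert (G1 : forall x, G (ext_map K x) = f x).
  { intros x. unfold G. destruct (constructive_indefinite_description _ _) as [v [H1 H2]].
    simpl; auto. }
  assert (G2 : forall q, ~ image_of K q -> G q = h q).
  { intros q N. unfold G. destruct (constructive_indefinite_description _ _) as [v [H1 H2]].
    simpl; auto. }
  exists (fun z => G (proj1_sig z)). split; [|intros; apply G1].
  apply continuous_intro; [apply subspace_topology; auto|].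
  intros [q Hq] eps He; simpl.
  destruct (classic (image_of K q)) as [[x Ex]|N].
  - destruct (continuous_nbhd f x eps Hf He) as [V [HV [Vx HfV]]].
    destruct (Oe V HV) as [W [HW EW]].
    (* If [p] lies off [X], it is cut away from the neighbourhood of [q], so that only points of [X]
       remain there. *)
    assert (exists W', op W' /\ W' q /\ (image_of K p \/ ~ W' p)) as [W' [HW' [W'q D]]].
    { destruct (classic (image_of K p)) as [ip|ip].
      - exists (fun _ => True). split; [apply HT|auto].
      - exists (fun z => z <> p). split; [exact (closed_point p HT HH)|].
        split; [|auto]. intro; subst q; apply ip; exists x; auto. }
    exists (fun z => W (proj1_sig z) /\ W' (proj1_sig z)). split.
    { exists (fun z => W z /\ W' z). split; [apply op_and; auto|tauto]. }
    simpl. split; [split; auto; rewrite <- Ex; apply EW; auto|].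
    intros [q' Hq'] [Wq' W'q']; simpl in *.
    assert (image_of K q') as [x' Ex'].
    { destruct Hq' as [E|i]; auto. subst q'. destruct D; tauto. }
    subst q q'. rewrite !G1. apply HfV, EW, Wq'.
  - assert (E : q = p) by (destruct Hq; tauto). subst q.
    destruct (continuous_nbhd h p eps Hh He) as [V [HV [Vp HhV]]].
    exists (fun z => U (proj1_sig z) /\ V (proj1_sig z)). split.
    { exists (fun z => U z /\ V z). split; [apply op_and; auto|tauto]. }
    simpl. split; auto. intros [q' Hq'] [Uq' Vq']; simpl in *.
    rewrite (G2 p N).
    destruct (classic (image_of K q')) as [[x' Ex']|N'].
    + subst q'. rewrite G1, <- Hag by auto. apply HhV; auto.
    + rewrite (G2 q' N'). apply HhV; auto.
Qed.

Lemma compact_locally_bounded {X : space} (K : extension X) (f : X -> R) :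
  is_topology (ext_sp K) -> compact (ext_sp K) ->
  (forall p, locally_bounded_at K p f) -> exists M, forall x, Rabs (f x) <= M.
Proof.
  intros HT HC H.
  destruct (space_cover_compact HT HC (fun U => exists B, forall x, U (ext_map K x) ->
    Rabs (f x) <= B)) as [l [Hl Hcov]].
  { intros p _. destruct (H p) as [U [B [HU [Up HB]]]]. exists U. repeat split; auto.
    exists B; auto. }
  assert (exists M, forall U x, In U l -> U (ext_map K x) -> Rabs (f x) <= M) as [M HM].
  { clear Hcov. induction l as [|W l IH].
    - exists 0. intros U x [].
    - destruct IH as [M HM]; [intros; apply Hl; right; auto|].
      destruct (Hl W (or_introl eq_refl)) as [_ [B HB]].
      exists (Rmax B M). intros U x [E|E] Ux.
      + subst. pose proof (Rmax_l B M). specialize (HB x Ux). lra.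
      + pose proof (Rmax_r B M). specialize (HM U x E Ux). lra. }
  exists M. intros x. destruct (Hcov (ext_map K x) I) as [U [HU Ux]]. eauto.
Qed.

(** Otherwise every continuous function on [X] would be locally bounded at all points of the compact
    space [K], hence bounded. *)
Lemma rem_hewitt_nonempty {X : space} (K : extension X) :
  is_stone_cech K -> ~ pseudocompact X -> exists p, cl_rem_hewitt K p.
Proof.
  intros HK HP. apply NNPP; intro N. apply HP. intros f Hf.
  apply (compact_locally_bounded K f); try apply HK.
  intros p. apply hewitt_locally_bounded; auto.
  apply NNPP; intro Hp. apply N. exists p. apply subset_closure; auto.
Qed.

(** Every continuous function is bounded on a neighbourhood of [x] with pseudocompact closure, so an
    open set of [K] around [x] lies inside the realcompactification. *)
Lemma rem_hewitt_disjoint {X : space} (K : extension X) p :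
  is_topology X -> is_stone_cech K -> locally_pseudocompact X ->
  cl_rem_hewitt K p -> ~ image_of K p.
Proof.
  intros HX HK HL Hp [x Ex]. subst p.
  destruct (HL x) as [U [HU [Ux HP]]].
  assert (Oe := proj2 (proj2 (proj1 (proj2 (proj1 HK))))).
  destruct (Oe U HU) as [U' [HU' E]].
  destruct (Hp U' HU') as [p [U'p Np]]; [apply E; auto|].
  apply Np. apply locally_bounded_hewitt; auto. intros f Hf.
  destruct (HP (fun z => f (proj1_sig z))) as [M HM].
  { intros V HV. exists (fun z => V (f z)). split; [apply (Hf V HV)|tauto]. }
  exists U', M. repeat split; auto. intros y Uy. apply E in Uy.
  exact (HM (exist _ y (subset_closure _ _ Uy))).
Qed.

Lemma rem_hewitt_closed {X : space} (K : extension X) :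
  is_stone_cech K -> closed (cl_rem_hewitt K).
Proof. intros HK. apply closure_closed. apply HK. Qed.

(** * Traces of extensions on the Stone–Čech compactification *)

(* [(p, y)] lies in the closure of the diagonal copy of [X] in [K * E]; for
   [K] the Stone–Čech compactification this is the graph of the canonical map
   to the Stone–Čech compactification of [E], restricted to the preimage of [E]. *)
Definition adh {X : space} (K E : extension X) (p : ext_sp K) (y : ext_sp E) : Prop :=
  forall U V, op U -> U p -> op V -> V y ->
    exists x, U (ext_map K x) /\ V (ext_map E x).

(* The partial equivalence relation on [K] whose domain is the preimage of [E]
   and whose classes are the fibres over [E]. *)
Definition rel {X : space} (K E : extension X) (p q : ext_sp K) : Prop :=
  exists y, adh K E p y /\ adh K E q y.

Lemma not_adh {X : space} (K E : extension X) p y : ~ adh K E p y ->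
  exists U V, op U /\ U p /\ op V /\ V y /\
    forall s t, U s -> V t -> ~ exists x, ext_map K x = s /\ ext_map E x = t.
Proof.
  intros H. apply NNPP; intro N. apply H. intros U V HU Up HV Vy.
  apply NNPP; intro N'. apply N. exists U, V. repeat split; auto.
  intros s t Us Vt [x [E1 E2]]. subst. apply N'. exists x; auto.
Qed.

Lemma adh_image {X : space} (K E : extension X) x : adh K E (ext_map K x) (ext_map E x).
Proof. intros U V _ Ux _ Vx. exists x; auto. Qed.

Lemma adh_value {X : space} (K E : extension X) p y
    (h : ext_sp E -> RealLine) (k : ext_sp K -> RealLine) :
  continuous h -> continuous k -> (forall x, k (ext_map K x) = h (ext_map E x)) ->
  adh K E p y -> k p = h y.
Proof.
  intros Hh Hk Ehk Hp. apply NNPP; intro N.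
  destruct (RealLine_Hausdorff (k p) (h y) N) as [U [V [HU [HV [Up [Vy D]]]]]].
  destruct (Hp _ _ (Hk U HU) Up (Hh V HV) Vy) as [x [H1 H2]].
  rewrite <- Ehk in H2. apply (D (k (ext_map K x))); auto.
Qed.

Lemma pullback_extends {X : space} (K E : extension X) (h : ext_sp E -> RealLine) :
  is_stone_cech K -> is_extension E -> continuous h -> (forall y, 0 <= h y <= 1) ->
  exists k : ext_sp K -> RealLine, continuous k /\
    forall x, k (ext_map K x) = h (ext_map E x).
Proof.
  intros HK HE Hh Hb.
  apply (bounded_extends K (fun x => h (ext_map E x)) 1 HK).
  - intros V HV. apply (proj1 (proj1 (proj2 HE)) (fun y => V (h y))). apply (Hh V HV).
  - intros x. specialize (Hb (ext_map E x)). rewrite Rabs_right; lra.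
Qed.

(** A function on [E] separating [y] from [z] pulls back to [K], and the pullback would take both
    values at [p]. *)
Lemma adh_unique {X : space} (K E : extension X) p y z :
  is_stone_cech K -> is_extension E -> adh K E p y -> adh K E p z -> y = z.
Proof.
  intros HK HE Hy Hz. apply NNPP; intro N.
  destruct (proj1 HE) as [HT [HH HR]].
  destruct (HR (fun w => w = z) y) as [h [Hh [h0 [h1 hb]]]]; auto.
  { apply closed_point; auto. }
  destruct (pullback_extends K E h HK HE Hh hb) as [k [Hk Ek]].
  pose proof (adh_value K E p y h k Hh Hk Ek Hy).
  pose proof (adh_value K E p z h k Hh Hk Ek Hz).
  specialize (h1 z eq_refl). lra.
Qed.

(** If no point of [K] clustered at [y], compactness of [K] would give a neighbourhood of [y]
    missing [X], against density. *)
Lemma adh_surjective {X : space} (K E : extension X) y :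
  is_stone_cech K -> is_extension E -> exists p, adh K E p y.
Proof.
  intros HK HE. apply NNPP; intro N.
  destruct (tube (fun _ : ext_sp K => True) y
    (fun s t => exists x, ext_map K x = s /\ ext_map E x = t))
    as [U [V [HU [cU [HV [Vy D]]]]]].
  - apply HK.
  - apply HE.
  - apply space_cover_compact; apply HK.
  - intros p _. apply not_adh. intro H; apply N; exists p; exact H.
  - destruct (ext_dense E V y HE HV Vy) as [x Vx].
    apply (D (ext_map K x) (ext_map E x)); auto. exists x; auto.
Qed.

Lemma adh_image_inv {X : space} (K E : extension X) p x :
  is_stone_cech K -> is_extension E -> adh K E p (ext_map E x) -> p = ext_map K x.
Proof.
  intros HK HE Hp. apply NNPP; intro N.
  destruct (proj1 (proj2 (proj1 (proj1 HK))) _ _ N) as [U [V [HU [HV [Up [Vx D]]]]]].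
  destruct (proj1 (proj2 HE)) as [_ [_ Oe]].
  destruct (Oe (fun z => V (ext_map K z))) as [W [HW EW]].
  { apply (proj1 (proj1 (proj2 (proj1 HK)))); auto. }
  destruct (Hp U W HU Up HW) as [x' [H1 H2]]; [apply EW; auto|].
  apply (D (ext_map K x')). split; auto. apply EW; auto.
Qed.

Lemma rel_sym {X : space} (K E : extension X) p q : rel K E p q -> rel K E q p.
Proof. intros [y [H1 H2]]; exists y; auto. Qed.

Lemma rel_trans {X : space} (K E : extension X) p q r :
  is_stone_cech K -> is_extension E -> rel K E p q -> rel K E q r -> rel K E p r.
Proof.
  intros HK HE [y [H1 H2]] [z [H3 H4]].
  rewrite (adh_unique K E q z y) in H4; auto. exists y; auto.
Qed.

Lemma rel_image {X : space} (K E : extension X) p q :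
  is_stone_cech K -> is_extension E -> image_of K p -> rel K E p q -> p = q.
Proof.
  intros HK HE [x Ex] [y [H1 H2]]. subst p.
  pose proof (adh_unique K E _ _ _ HK HE H1 (adh_image K E x)). subst y.
  symmetry; eapply adh_image_inv; eauto.
Qed.

Lemma rel_image_refl {X : space} (K E : extension X) p : image_of K p -> rel K E p p.
Proof. intros [x Ex]; subst. exists (ext_map E x). split; apply adh_image. Qed.

Lemma rel_class_closed {X : space} (K E : extension X) p :
  is_stone_cech K -> is_extension E -> closed (fun q => rel K E q p).
Proof.
  intros HK HE. apply op_local; [apply HK|]. intros q Hq.
  destruct (classic (exists y, adh K E p y)) as [[y Hy]|N].
  - destruct (not_adh K E q y) as [U [V [HU [Uq [HV [Vy D]]]]]].
    { intro H; apply Hq; exists y; auto. }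
    exists U. repeat split; auto. intros q' Uq' [z [H1 H2]].
    rewrite (adh_unique K E p z y) in H1; auto.
    destruct (H1 U V HU Uq' HV Vy) as [x [h1 h2]].
    apply (D _ _ h1 h2). exists x; auto.
  - exists (fun _ => True). split; [apply HK|]. split; auto.
    intros q' _ [z [_ H]]. apply N; exists z; auto.
Qed.

(** When the relation of [E'] is contained in that of [E], each fibre over [E'] lies in a single
    fibre over [E], and this defines the map from [E'] to [E]. *)
Lemma ext_le_rel {X : space} (K E E' : extension X) :
  is_stone_cech K -> is_extension E -> is_extension E' ->
  (ext_le E E' <-> forall p q, rel K E' p q -> rel K E p q).
Proof.
  intros HK HE HE'. split.
  - intros [g [Hg Eg]] p q.
    assert (T : forall p y, adh K E' p y -> adh K E p (g y)).
    { intros p' y H U V HU Up HV Vy.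
      destruct (H U (fun z => V (g z)) HU Up (Hg V HV) Vy) as [x [H1 H2]].
      rewrite Eg in H2. exists x; auto. }
    intros [y [H1 H2]]. exists (g y). split; apply T; auto.
  - intros H.
    assert (Hg : forall y', exists y, forall p, adh K E' p y' -> adh K E p y).
    { intros y'. destruct (adh_surjective K E' y' HK HE') as [p Hp].
      destruct (H p p) as [y [Hy _]]; [exists y'; auto|].
      exists y. intros q Hq. destruct (H p q) as [z [H1 H2]]; [exists y'; auto|].
      rewrite (adh_unique K E p y z); auto. }
    pose (g := fun y' => proj1_sig (constructive_indefinite_description _ (Hg y'))).
    assert (gP : forall y' p, adh K E' p y' -> adh K E p (g y')).
    { intros y'. unfold g. destruct (constructive_indefinite_description _ _); auto. }
    exists g. split.
    + intros V HV. apply op_local; [apply HE'|]. intros y0 Vy0.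
      destruct (proj2 (proj2 (proj1 HE)) (fun z => ~ V z) (g y0))
        as [h [Hh [h0 [h1 hb]]]].
      { unfold closed. apply (op_ext V); auto. intros x; split; [auto|apply NNPP]. }
      { auto. }
      destruct (pullback_extends K E h HK HE Hh hb) as [k [Hk Ek]].
      (* The fibre over [y0] misses the compact set where [k] is at least 1/2, so the fibres over
         some neighbourhood [W] of [y0] miss it too. Hence [h (g y) < 1/2] on [W], which forces
         [g y] into [V]. *)
      destruct (tube (fun p => ~ k p < 1 / 2) y0
        (fun s t => exists x, ext_map K x = s /\ ext_map E' x = t))
        as [U [W [HU [cU [HW [Wy D]]]]]].
      * apply HK.
      * apply HE'.
      * apply closed_cover_compact; try apply HK.
        unfold closed. apply (op_ext (fun p => k p < 1 / 2)).
        { intros x; split; [auto|apply NNPP]. }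
        apply open_lt; auto.
      * intros p Hp. apply not_adh. intro Ha. apply Hp.
        rewrite (adh_value K E p (g y0) h k); auto. lra.
      * exists W. repeat split; auto. intros y Wy'.
        destruct (adh_surjective K E' y HK HE') as [p Hp].
        assert (kp : k p < 1 / 2).
        { apply NNPP; intro Np. destruct (Hp U W HU (cU p Np) HW Wy') as [x [H1 H2]].
          apply (D _ _ H1 H2). exists x; auto. }
        rewrite (adh_value K E p (g y) h k) in kp; auto.
        apply NNPP; intro NV. specialize (h1 _ NV). lra.
    + intros x. apply (adh_unique K E (ext_map K x)); auto.
      * apply gP, adh_image.
      * apply adh_image.
Qed.

(* If [p] did not cluster at the compact remainder of [E], a function of [X]
   unbounded near [p], cut off outside a neighbourhood of [p], would extend by
   zero to an unbounded function on [E]. *)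
Lemma rem_hewitt_rel {X : space} (K E : extension X) p :
  is_topology X -> is_stone_cech K -> in_U X E -> cl_rem_hewitt K p -> rel K E p p.
Proof.
  intros HX HK [HE [HP HC]] Hp. apply NNPP; intro N.
  apply compact_subspace_cover in HC.
  destruct (proj1 HE) as [HT [HH HR]].
  (* Compactness of the remainder separates it from [p]: no point of [X] lies in both [V] and
     [U]. *)
  destruct (tube (remainder E) p
    (fun s t => exists x, ext_map E x = s /\ ext_map K x = t))
    as [V [U [HV [cV [HU [Up D]]]]]]; auto.
  { apply HK. }
  { intros y _. destruct (not_adh K E p y) as [U [V [HU [Up [HV [Vy D]]]]]].
    { intro H; apply N; exists y; auto. }
    exists V, U. repeat split; auto. intros s t Vs Ut [x [H1 H2]].
    apply (D t s); auto. exists x; auto. }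
  destruct (Hp U HU Up) as [q [Uq Nq]]. apply Nq.
  apply locally_bounded_hewitt; auto. intros f Hf.
  destruct (proj2 (proj2 (proj1 (proj1 HK))) (fun z => ~ U z) q)
    as [k [Hk [k0 [k1 kb]]]].
  { unfold closed. apply (op_ext U); auto. intros x; split; [auto|apply NNPP]. }
  { auto. }
  pose (m := fun x => f x * (1 - k (ext_map K x))).
  assert (Hm : @continuous X RealLine m).
  { apply continuous_mult; auto.
    - intros x. specialize (kb (ext_map K x)). rewrite Rabs_right; lra.
    - apply (continuous_lipschitz (fun x => k (ext_map K x)) (fun u => 1 - u) 1); auto.
      + lra.
      + intros u v. replace (1 - u - (1 - v)) with (- (u - v)) by ring.
        rewrite Rabs_Ropp; lra.
      + intros W HW. apply (proj1 (proj1 (proj2 (proj1 HK))) _ (Hk W HW)). }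
  destruct (proj1 (proj2 HE)) as [Ce [Ie Oe]].
  assert (HF : forall y, exists v : R,
    (forall x, ext_map E x = y -> v = m x) /\ (remainder E y -> v = 0)).
  { intros y. destruct (classic (image_of E y)) as [[x Ex]|Ny].
    - exists (m x). split.
      + intros x' E'. f_equal. apply Ie. congruence.
      + intros Ny; exfalso; apply Ny; exists x; auto.
    - exists 0. split; auto. intros x Ex; exfalso; apply Ny; exists x; auto. }
  pose (F := fun y => proj1_sig (constructive_indefinite_description _ (HF y))).
  assert (F1 : forall x, F (ext_map E x) = m x).
  { intros x. unfold F. destruct (constructive_indefinite_description _ _) as [v [H1 H2]].
    simpl; auto. }
  assert (F2 : forall y, remainder E y -> F y = 0).
  { intros y Ny. unfold F. destruct (constructive_indefinite_description _ _) as [v [H1 H2]].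
    simpl; auto. }
  assert (F3 : forall y, V y -> F y = 0).
  { intros y Vy. destruct (classic (remainder E y)) as [Ny|Ny]; auto.
    apply NNPP in Ny. destruct Ny as [x Ex]. subst y. rewrite F1. unfold m.
    rewrite k1; [ring|]. intro Ux. apply (D _ _ Vy Ux). exists x; auto. }
  assert (HFc : @continuous (ext_sp E) RealLine F).
  { apply continuous_intro; auto. intros y eps He.
    destruct (classic (remainder E y)) as [Ny|Ny].
    - exists V. repeat split; auto. intros z Vz. rewrite !F3; auto.
      replace (0 - 0) with 0 by ring. rewrite Rabs_R0; auto.
    - pose proof Ny as Ny'. apply NNPP in Ny. destruct Ny as [x Ex]. subst y.
      destruct (continuous_nbhd m x eps Hm He) as [W [HW [Wx HmW]]].
      destruct (Oe W HW) as [W' [HW' EW]].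
      exists (fun z => W' z /\ ~ remainder E z). split.
      (* The compact remainder is closed, so [X] is open in [E] and continuity at its points can be
         checked inside [X]. *)
      { apply op_and; auto. exact (cover_compact_closed _ HT HH HC). }
      split; [split; auto; apply EW; auto|].
      intros z [W'z Nz]. apply NNPP in Nz. destruct Nz as [x' Ex']. subst z.
      rewrite !F1. apply HmW, EW, W'z. }
  destruct (HP F HFc) as [M HM].
  (* Here the cut-off factor [1 - k] exceeds 1/2, so the bound [M] for the product gives [2 * M] for
     [f]. *)
  exists (fun z => k z < 1 / 2), (2 * M). split; [apply open_lt; auto|].
  split; [lra|]. intros x kx. specialize (HM (ext_map E x)). rewrite F1 in HM.
  unfold m in HM. rewrite Rabs_mult in HM.
  rewrite (Rabs_right (1 - k (ext_map K x))) in HM by lra.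
  pose proof (Rabs_pos (f x)).
  assert (Rabs (f x) * (1 / 2) <= Rabs (f x) * (1 - k (ext_map K x)))
    by (apply Rmult_le_compat_l; lra).
  lra.
Qed.

(** * Extensions with a prescribed trace *)

Definition const_on {K : space} (C : K -> Prop) (c : K) (k : K -> RealLine) : Prop :=
  continuous k /\ forall q, C q -> k q = k c.

(* The subspace [X u H] of [K] with [C] shrunk to its element [c]: the points of
   [C] other than [c] are dropped, and the topology is the weak one given by the
   functions of [K] that are constant on [C]. *)
Definition collapse_sp {X : space} (K : extension X) (H C : ext_sp K -> Prop)
    (c : ext_sp K) : space :=
  Space {q : ext_sp K | image_of K q \/ (H q /\ (C q -> q = c))}
    (fun V => forall x, V x -> exists k, const_on C c k /\ k (proj1_sig x) = 0 /\
       (forall q, 0 <= k q) /\ forall z, k (proj1_sig z) < 1 -> V z).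

Definition collapse {X : space} (K : extension X) (H C : ext_sp K -> Prop)
    (c : ext_sp K) : extension X :=
  Ext X (collapse_sp K H C c)
    (fun x => exist _ (ext_map K x) (or_introl (ex_intro _ x eq_refl))).

Definition collapsible {X : space} (K : extension X) (H C : ext_sp K -> Prop)
    (c : ext_sp K) : Prop :=
  closed H /\ closed C /\ (forall q, H q -> ~ image_of K q) /\
  (forall q, C q -> H q) /\ C c /\ (forall q, cl_rem_hewitt K q -> H q).

Lemma continuous_dist {S : space} (k : S -> RealLine) a r : is_topology S -> 0 < r ->
  continuous k -> @continuous S RealLine (fun q => Rabs (k q - a) / r).
Proof.
  intros HS Hr Hk.
  apply (continuous_lipschitz k (fun u => Rabs (u - a) / r) (/ r)); auto.
  { apply Rinv_0_lt_compat; auto. }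
  intros u v. unfold Rdiv. rewrite <- Rmult_minus_distr_r, Rabs_mult.
  rewrite (Rabs_right (/ r)) by (apply Rle_ge, Rlt_le, Rinv_0_lt_compat; auto).
  rewrite Rmult_comm. apply Rmult_le_compat_l.
  { apply Rlt_le, Rinv_0_lt_compat; auto. }
  eapply Rle_trans; [apply Rabs_triang_inv2|].
  replace (u - a - (v - a)) with (u - v) by ring. lra.
Qed.

Lemma collapse_topology {X : space} (K : extension X) H C c :
  is_topology (ext_sp K) -> is_topology (collapse_sp K H C c).
Proof.
  intros HT. split; [|split].
  - intros x _. exists (fun _ => 0). repeat split; auto; try (intros; lra).
    intros V HV. apply op_local; auto. intros y Vy. exists (fun _ => True).
    split; [apply HT|auto].
  - intros U V HU HV x [Ux Vx].
    destruct (HU x Ux) as [k [[Hk Ck] [k0 [kp kU]]]].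
    destruct (HV x Vx) as [m [[Hm Cm] [m0 [mp mV]]]].
    (* Both functions are nonnegative, so the unit ball of the sum lies in both unit balls. *)
    exists (fun q => k q + m q). split; [split|split; [|split]].
    + apply continuous_plus; auto.
    + intros q Cq. rewrite (Ck q Cq), (Cm q Cq); auto.
    + rewrite k0, m0; lra.
    + intros q; specialize (kp q); specialize (mp q); lra.
    + intros z Hz. specialize (kp (proj1_sig z)); specialize (mp (proj1_sig z)).
      split; [apply kU | apply mV]; lra.
  - intros F HF x [U [FU Ux]]. destruct (HF U FU x Ux) as [k [Ck [k0 [kp kU]]]].
    exists k. repeat split; auto; try apply Ck. intros z Hz. exists U; auto.
Qed.

Lemma collapse_continuous {X : space} (K : extension X) H C c (k : ext_sp K -> RealLine) :
  is_topology (ext_sp K) -> const_on C c k ->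
  @continuous (collapse_sp K H C c) RealLine (fun z => k (proj1_sig z)).
Proof.
  intros HT [Hk Ck] V HV x Vx. destruct (HV _ Vx) as [r [Hr HrV]].
  (* Dividing by [r] turns the ball of radius [r] into the unit ball required by the topology of the
     collapse. *)
  exists (fun q => Rabs (k q - k (proj1_sig x)) / r). split; [split|split; [|split]].
  - apply continuous_dist; auto.
  - intros q Cq. rewrite (Ck q Cq); auto.
  - replace (k (proj1_sig x) - k (proj1_sig x)) with 0 by ring.
    rewrite Rabs_R0. apply Rmult_0_l.
  - intros q. unfold Rdiv. apply Rmult_le_pos; [apply Rabs_pos|].
    apply Rlt_le, Rinv_0_lt_compat; auto.
  - intros z Hz. apply HrV.
    apply (Rmult_lt_compat_r r) in Hz; auto.
    unfold Rdiv in Hz. rewrite Rmult_assoc, Rinv_l in Hz; lra.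
Qed.

(** Complete regularity is applied to [p] and the union of [C] and [q]; the function is then 1
    throughout [C]. *)
Lemma separate_points {S : space} (C : S -> Prop) c p q :
  Tychonoff S -> closed C -> C c -> ~ C p -> p <> q ->
  exists k, const_on C c k /\ k p = 0 /\ k q = 1 /\ forall z, 0 <= k z <= 1.
Proof.
  intros [HT [HH HR]] HC Cc Np Npq.
  destruct (HR (fun z => C z \/ z = q) p) as [k [Hk [k0 [k1 kb]]]].
  - apply closed_or; auto. apply closed_point; auto.
  - tauto.
  - exists k. split; [split|]; auto. intros z Cz. rewrite !k1; auto.
Qed.

(** The only point of the collapse inside [C] is [c], because [C] lies in [H] and so misses [X].
    Thus one of two distinct points can play the role of [p] in [separate_points]. *)
Lemma collapse_not_both {X : space} (K : extension X) H C c (x y : collapse_sp K H C c) :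
  collapsible K H C c -> x <> y -> ~ C (proj1_sig x) \/ ~ C (proj1_sig y).
Proof.
  intros [_ [_ [DH [CH _]]]] N. apply NNPP; intro N'. apply N, sig_ext.
  apply not_or_and in N'. destruct N' as [N1 N2]. apply NNPP in N1, N2.
  destruct x as [x [ix|[hx cx]]]; simpl in *; [destruct (DH x); auto|].
  destruct y as [y [iy|[hy cy]]]; simpl in *; [destruct (DH y); auto|].
  rewrite cx, cy; auto.
Qed.

Lemma Rmin_lipschitz a u v : Rabs (Rmin a u - Rmin a v) <= 1 * Rabs (u - v).
Proof.
  unfold Rmin, Rabs. destruct (Rle_dec a u), (Rle_dec a v);
  repeat match goal with |- context [Rcase_abs ?a] => destruct (Rcase_abs a) end; lra.
Qed.

Lemma collapse_Tychonoff {X : space} (K : extension X) H C c :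
  Tychonoff (ext_sp K) -> collapsible K H C c -> Tychonoff (collapse_sp K H C c).
Proof.
  intros HT HC. pose proof (collapse_topology K H C c (proj1 HT)) as HS.
  pose proof HC as [clH [clC [DH [CH [Cc _]]]]].
  split; [exact HS|]. split.
  - assert (G : forall x y : collapse_sp K H C c, x <> y -> ~ C (proj1_sig x) ->
      exists U V : collapse_sp K H C c -> Prop, op U /\ op V /\ U x /\ V y /\
        forall z, ~ (U z /\ V z)).
    { intros x y Nxy Nx.
      destruct (separate_points C c (proj1_sig x) (proj1_sig y) HT clC Cc Nx)
        as [k [Ck [k0 [k1 _]]]].
      { intro E; apply Nxy, sig_ext, E. }
      pose proof (collapse_continuous K H C c k (proj1 HT) Ck) as Hk.
      exists (fun z => k (proj1_sig z) < 1 / 2), (fun z => 1 / 2 < k (proj1_sig z)).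
      split; [exact (open_lt _ _ Hk)|]. split; [exact (open_gt _ _ Hk)|].
      split; [lra|]. split; [lra|]. intros z Hz; lra. }
    intros x y Nxy. destruct (collapse_not_both K H C c x y HC Nxy) as [N|N].
    + apply G; auto.
    + destruct (G y x) as [U [V [HU [HV [Uy [Vx D]]]]]]; auto.
      exists V, U. repeat split; auto. intros z [h1 h2]. apply (D z); auto.
  - intros F x HF Nx. destruct (HF x Nx) as [k [Ck [k0 [kp kF]]]].
    (* The function witnessing that the complement of [F] is a neighbourhood of [x] is at least 1 on
       [F]; truncation makes it equal to 1 there. *)
    exists (fun z => Rmin 1 (k (proj1_sig z))). split; [|split; [|split]].
    + apply (continuous_lipschitz (fun z : collapse_sp K H C c => k (proj1_sig z))
               (Rmin 1) 1 HS); [lra|apply Rmin_lipschitz|].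
      apply collapse_continuous; auto. apply HT.
    + rewrite k0. apply Rmin_right; lra.
    + intros y Fy. apply Rmin_left. apply Rnot_lt_le. intro L. apply (kF y L Fy).
    + intros y. split; [apply Rmin_glb; [lra|apply kp]|apply Rmin_l].
Qed.

Lemma collapse_is_extension {X : space} (K : extension X) H C c :
  is_topology X -> is_stone_cech K -> collapsible K H C c ->
  is_extension (collapse K H C c).
Proof.
  intros HX HK HC. pose proof (proj1 HK) as HE.
  pose proof (proj1 HE) as HT. pose proof (proj1 (proj2 HE)) as [Ce [Ie Oe]].
  pose proof HC as [clH [clC [DH [CH [Cc _]]]]].
  split; [apply collapse_Tychonoff; auto|]. split; [split; [|split]|].
  - intros V HV. apply op_local; auto. intros x Vx.
    destruct (HV _ Vx) as [k [[Hk Ck] [k0 [kp kV]]]].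
    exists (fun z => k (ext_map K z) < 1). split.
    + apply (Ce (fun q => k q < 1)). apply open_lt; auto.
    + simpl in k0. split; [rewrite k0; lra|]. intros y Hy. apply kV; exact Hy.
  - intros x y E. apply Ie. exact (f_equal (@proj1_sig _ _) E).
  - intros U HU. destruct (Oe U HU) as [U' [HU' E]].
    (* Removing [C] loses no point of [X], and makes the separating functions 1 on all of [C]. *)
    exists (fun z => U' (proj1_sig z) /\ ~ C (proj1_sig z)). split.
    + intros x [Ux Nx].
      destruct (proj2 (proj2 HT) (fun q => ~ (U' q /\ ~ C q)) (proj1_sig x))
        as [k [Hk [k0 [k1 kb]]]].
      { apply (op_ext (fun q => U' q /\ ~ C q)).
        - intros q; split; [auto|apply NNPP].
        - apply op_and; auto; apply HT. }
      { auto. }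
      exists k. split; [split; auto|split; auto; split].
      * intros q Cq. rewrite !k1; tauto.
      * intros q; apply kb.
      * intros z Hz. apply NNPP; intro Nz. rewrite k1 in Hz; auto. lra.
    + intros x; simpl. rewrite E. split; [|tauto]. intros Ux; split; auto.
      intro Cx. apply (DH _ (CH _ Cx)). exists x; auto.
  - intros z V HV Vz. destruct (HV z Vz) as [k [[Hk Ck] [k0 [kp kV]]]].
    destruct (ext_dense K (fun q => k q < 1) (proj1_sig z) HE) as [x Hx].
    + apply open_lt; auto.
    + rewrite k0; lra.
    + exists (ext_map (collapse K H C c) x). split; [apply kV; exact Hx|exists x; auto].
Qed.

(** Graph of the quotient map from [X u H] onto the collapse. *)
Definition represents {X : space} (K : extension X) H C c
    (z : collapse_sp K H C c) (q : ext_sp K) : Prop :=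
  proj1_sig z = q \/ (C q /\ proj1_sig z = c).

Lemma represented {X : space} (K : extension X) H C c q :
  collapsible K H C c -> image_of K q \/ H q -> exists z, represents K H C c z q.
Proof.
  intros [_ [_ [_ [CH [Cc _]]]]] [iq|hq].
  - exists (exist _ q (or_introl iq)). left; auto.
  - destruct (classic (C q)) as [Cq|Nq].
    + exists (exist _ c (or_intror (conj (CH c Cc) (fun _ => eq_refl)))). right; auto.
    + exists (exist _ q (or_intror (conj hq (fun h => False_ind _ (Nq h))))). left; auto.
Qed.

Lemma represents_value {X : space} (K : extension X) H C c z q k :
  represents K H C c z q -> const_on C c k -> k (proj1_sig z) = k q.
Proof.
  intros [E|[Cq E]] [_ Ck]; rewrite E; auto. symmetry; auto.
Qed.

(** If [z] is not the image of [p], a function constant on [C] separates them, although it descends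
    to the collapse and must agree at [p] and [z]. Conversely, basic neighbourhoods of the image of
    [p] pull back to neighbourhoods of [p]. *)
Lemma collapse_adh {X : space} (K : extension X) H C c p z :
  is_stone_cech K -> collapsible K H C c ->
  (adh K (collapse K H C c) p z <-> represents K H C c z p).
Proof.
  intros HK HC. pose proof HC as [clH [clC [DH [CH [Cc _]]]]].
  pose proof (proj1 (proj1 HK)) as HT. split.
  - intros Ha. apply NNPP; intro N. apply not_or_and in N. destruct N as [N1 N2].
    assert (exists k, const_on C c k /\ k p <> k (proj1_sig z)) as [k [Ck Nk]].
    { destruct (classic (C p)) as [Cp|Np].
      - assert (Nz : ~ C (proj1_sig z)).
        { intro Cz. apply N2. split; auto.
          destruct z as [z [iz|[hz cz]]]; simpl in *; auto.
          exfalso; apply (DH z); auto. }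
        destruct (separate_points C c (proj1_sig z) p HT clC Cc Nz) as [k [Ck [k0 [k1 _]]]];
          auto.
        exists k. split; auto. rewrite k0, k1; lra.
      - destruct (separate_points C c p (proj1_sig z) HT clC Cc Np) as [k [Ck [k0 [k1 _]]]];
          auto.
        exists k. split; auto. rewrite k0, k1; lra. }
    apply Nk.
    apply (adh_value K (collapse K H C c) p z
             (fun w : collapse_sp K H C c => k (proj1_sig w)) k); auto.
    + apply collapse_continuous; auto. apply HT.
    + apply Ck.
  - intros Hr U V HU Up HV Vz. destruct (HV z Vz) as [k [Ck [k0 [kp kV]]]].
    rewrite (represents_value K H C c z p k Hr Ck) in k0.
    destruct (ext_dense K (fun q => U q /\ k q < 1) p (proj1 HK)) as [x [Ux kx]].
    + apply op_and; auto; [apply HT|]. apply open_lt, Ck.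
    + split; auto; lra.
    + exists x. split; [exact Ux|]. apply kV; exact kx.
Qed.

Lemma collapse_rel {X : space} (K : extension X) H C c p q :
  is_stone_cech K -> collapsible K H C c ->
  (rel K (collapse K H C c) p q <->
   (p = q /\ (image_of K p \/ H p)) \/ (C p /\ C q)).
Proof.
  intros HK HC. pose proof HC as [clH [clC [DH [CH [Cc _]]]]].
  unfold rel. split.
  - intros [z [Hp Hq]].
    apply collapse_adh in Hp; auto. apply collapse_adh in Hq; auto.
    assert (Hz : image_of K (proj1_sig z) \/ H (proj1_sig z))
      by (destruct (proj2_sig z) as [?|[? _]]; auto).
    destruct Hp as [E|[Cp E]], Hq as [E'|[Cq E']].
    + left. rewrite <- E, <- E'. auto.
    + right. rewrite <- E, E'. auto.
    + right. rewrite <- E', E. auto.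
    + auto.
  - intros [[E Hp]|[Cp Cq]].
    + subst q. destruct (represented K H C c p HC Hp) as [z Hz].
      exists z. split; apply collapse_adh; auto.
    + exists (exist _ c (or_intror (conj (CH c Cc) (fun _ => eq_refl)))).
      split; apply collapse_adh; auto; right; auto.
Qed.

(** For pseudocompactness, a function on the collapse is locally bounded at every point of [K]: at
    points of the realcompactification by its restriction to [X], at all others because they lie in
    [H] and are represented in the collapse. Covers of the remainder are pulled back to the compact
    set [H]. *)
Lemma collapse_in_U {X : space} (K : extension X) H C c :
  is_topology X -> is_stone_cech K -> collapsible K H C c -> in_U X (collapse K H C c).
Proof.
  intros HX HK HC. pose proof HC as [clH [clC [DH [CH [Cc RH]]]]].
  pose proof (collapse_is_extension K H C c HX HK HC) as HE.
  pose proof (proj1 (proj1 (proj1 HK))) as HT.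
  split; [exact HE|]. split.
  - intros f Hf.
    destruct (compact_locally_bounded K (fun x => f (ext_map (collapse K H C c) x)))
      as [M HM]; try apply HK.
    { intros p. destruct (classic (hewitt K p)) as [Hp|Np].
      - apply (hewitt_locally_bounded K p
                 (fun x => f (ext_map (collapse K H C c) x)) Hp).
        intros V HV. apply (proj1 (proj1 (proj2 HE)) _ (Hf V HV)).
      - destruct (represented K H C c p HC) as [z Hz].
        { right. apply RH, subset_closure, Np. }
        destruct (continuous_nbhd f z 1 Hf) as [V [HV [Vz HfV]]]; [lra|].
        destruct (HV z Vz) as [k [Ck [k0 [kp kV]]]].
        rewrite (represents_value K H C c z p k Hz Ck) in k0.
        exists (fun q => k q < 1), (Rabs (f z) + 1). split; [apply open_lt, Ck|].
        split; [lra|]. intros x kx.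
        specialize (HfV _ (kV (ext_map (collapse K H C c) x) kx)).
        pose proof (Rabs_triang_inv (f (ext_map (collapse K H C c) x)) (f z)). lra. }
    (* The bound passes from [X] to the whole collapse by density. *)
    exists M. intros y. apply Rnot_lt_le; intro L.
    destruct (continuous_nbhd f y (Rabs (f y) - M) Hf) as [V [HV [Vy HfV]]]; [lra|].
    destruct (ext_dense (collapse K H C c) V y HE HV Vy) as [x Vx].
    specialize (HfV _ Vx). specialize (HM x). rewrite Rabs_minus_sym in HfV.
    pose proof (Rabs_triang_inv (f y) (f (ext_map (collapse K H C c) x))). lra.
  - apply cover_compact_subspace. intros P HP.
    assert (HHc : cover_compact H) by (apply closed_cover_compact; auto; apply HK).
    destruct (HHc (fun U : ext_sp K -> Prop => exists V : collapse_sp K H C c -> Prop, (op V /\ P V) /\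
        forall z q, U q -> represents K H C c z q -> V z)) as [l [Hl Hcov]].
    + intros q Hq. destruct (represented K H C c q HC) as [z Hz]; auto.
      destruct (HP z) as [V [HV [Vz PV]]].
      { intros [x Ex]. destruct HC as [_ [_ [_ [CH' _]]]].
        apply (f_equal (@proj1_sig _ _)) in Ex; simpl in Ex.
        apply (DH (proj1_sig z)); [|exists x; auto].
        destruct Hz as [E|[_ E]]; rewrite E; auto. }
      destruct (HV z Vz) as [k [Ck [k0 [kp kV]]]].
      rewrite (represents_value K H C c z q k Hz Ck) in k0.
      exists (fun w => k w < 1). split; [apply open_lt, Ck|]. split; [lra|].
      exists V. split; auto. intros z' q' kq Hr. apply kV.
      rewrite (represents_value K H C c z' q' k Hr Ck); auto.
    + destruct (list_lift (fun U (V : collapse_sp K H C c -> Prop) => (op V /\ P V) /\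
        forall z q, U q -> represents K H C c z q -> V z) l) as [l' [H1 H2]].
      { intros U HU. apply Hl; auto. }
      exists l'. split.
      * intros V HV. destruct (H1 V HV) as [U [_ [h _]]]; exact h.
      * intros z Nz. destruct (Hcov (proj1_sig z)) as [U [HU Uz]].
        { destruct (proj2_sig z) as [[x Ex]|[hz _]]; auto.
          exfalso; apply Nz. exists x. apply sig_ext; simpl; auto. }
        destruct (H2 U HU) as [V [HV [_ h]]]. exists V. split; auto.
        apply (h z (proj1_sig z)); auto. left; auto.
Qed.

(** * Coatoms of the order *)

Definition is_top {A : Type} (u : A -> Prop) (le : A -> A -> Prop) (m : A) : Prop :=
  u m /\ forall e, u e -> le e m.

(** Formulated for a preorder of representatives: inequality in both directions stands in for
    equality. *)
Definition is_coatom {A : Type} (u : A -> Prop) (le : A -> A -> Prop) (c : A) : Prop :=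
  u c /\ ~ is_top u le c /\ forall e, u e -> le c e -> le e c \/ is_top u le e.

(* Order-theoretic description of the coatoms of [U(X)] that identify two points
   of [cl (beta X \ upsilon X)].  The other coatoms add a point [p] to it, and
   nothing but that coatom lies above the extension identifying [p] with some
   point of the closure. *)
Definition is_pairlike {A : Type} (u : A -> Prop) (le : A -> A -> Prop) (c : A) : Prop :=
  is_coatom u le c /\ forall e, u e -> le e c ->
    le c e \/ exists c', is_coatom u le c' /\ le e c' /\ ~ le c' c.

Definition order_corr {A B : Type} (u : A -> Prop) (le : A -> A -> Prop)
    (v : B -> Prop) (le' : B -> B -> Prop) (R : A -> B -> Prop) : Prop :=
  (forall a b, R a b -> u a /\ v b) /\
  (forall a, u a -> exists b, R a b) /\ (forall b, v b -> exists a, R a b) /\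
  (forall a a' b b', R a b -> R a' b' -> (le a a' <-> le' b b')).

Lemma order_corr_sym {A B : Type} u le v le' (R : A -> B -> Prop) :
  order_corr u le v le' R -> order_corr v le' u le (fun b a => R a b).
Proof.
  intros [H1 [H2 [H3 H4]]]. repeat split; auto; try (eapply H1; eauto; fail);
  intros; eapply H4; eauto.
Qed.

Lemma order_corr_top {A B : Type} u le v le' (R : A -> B -> Prop) a b :
  order_corr u le v le' R -> R a b -> is_top u le a -> is_top v le' b.
Proof.
  intros [H1 [H2 [H3 H4]]] Rab [ua Ha]. split; [eapply H1; eauto|].
  intros e ve. destruct (H3 e ve) as [d Rde].
  apply (H4 d a e b); auto. apply Ha. eapply H1; eauto.
Qed.

Lemma order_corr_coatom {A B : Type} u le v le' (R : A -> B -> Prop) a b :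
  order_corr u le v le' R -> R a b -> is_coatom u le a -> is_coatom v le' b.
Proof.
  intros HR Rab [ua [Na Ha]]. pose proof HR as [H1 [H2 [H3 H4]]].
  split; [eapply H1; eauto|]. split.
  - intro T. apply Na. eapply (order_corr_top _ _ _ _ _ b a (order_corr_sym _ _ _ _ _ HR)); auto.
  - intros e ve L. destruct (H3 e ve) as [d Rde].
    destruct (Ha d) as [L'|T].
    + eapply H1; eauto.
    + apply (H4 a d b e); auto.
    + left. apply (H4 d a e b); auto.
    + right. eapply order_corr_top; eauto.
Qed.

Lemma order_corr_pairlike {A B : Type} u le v le' (R : A -> B -> Prop) a b :
  order_corr u le v le' R -> R a b -> is_pairlike u le a -> is_pairlike v le' b.
Proof.
  intros HR Rab [Ca Ha]. pose proof HR as [H1 [H2 [H3 H4]]].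
  split; [eapply order_corr_coatom; eauto|].
  intros e ve L. destruct (H3 e ve) as [d Rde].
  destruct (Ha d) as [L'|[c' [Cc' [L1 L2]]]].
  - eapply H1; eauto.
  - apply (H4 d a e b); auto.
  - left. apply (H4 a d b e); auto.
  - right. destruct (H2 c' (proj1 Cc')) as [f Rcf]. exists f. split; [|split].
    + eapply order_corr_coatom; eauto.
    + apply (H4 d c' e f); auto.
    + intro L'. apply L2. apply (H4 c' a f b); auto.
Qed.

(** Here [set_disj] expresses the effect of local pseudocompactness and [set_ne] that of the failure
    of pseudocompactness. *)
Record setting {X : space} (K : extension X) : Prop := Setting {
  set_top : is_topology X;
  set_sc : is_stone_cech K;
  set_disj : forall p, cl_rem_hewitt K p -> ~ image_of K p;
  set_ne : exists p, cl_rem_hewitt K p }.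

(** The smallest domain of a relation coming from [U(X)]; it is the domain of the top element. *)
Definition base {X : space} (K : extension X) (p : ext_sp K) : Prop :=
  image_of K p \/ cl_rem_hewitt K p.

Lemma in_U_le {X : space} (K E E' : extension X) :
  setting K -> in_U X E -> in_U X E' ->
  (ext_le E E' <-> forall p q, rel K E' p q -> rel K E p q).
Proof. intros HS HE HE'. apply ext_le_rel; [apply HS|apply HE|apply HE']. Qed.

Lemma base_refl {X : space} (K E : extension X) p :
  setting K -> in_U X E -> base K p -> rel K E p p.
Proof.
  intros HS HE [H|H]; [apply rel_image_refl; auto|].
  apply rem_hewitt_rel; auto; apply HS.
Qed.

Lemma in_U_rel_image {X : space} (K E : extension X) p q :
  setting K -> in_U X E -> image_of K p \/ image_of K q -> rel K E p q -> p = q.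
Proof.
  intros HS HE [H|H] Hr; [|symmetry; apply rel_sym in Hr];
    eapply rel_image; eauto; try apply HS; apply HE.
Qed.

Lemma realize_base {X : space} (K : extension X) (C : ext_sp K -> Prop) c :
  setting K -> closed C -> (forall q, C q -> cl_rem_hewitt K q) -> C c ->
  exists E, in_U X E /\ forall p q, rel K E p q <-> (p = q /\ base K p) \/ (C p /\ C q).
Proof.
  intros HS HC CH Cc. destruct HS as [h1 h2 h3 h4].
  assert (G : collapsible K (cl_rem_hewitt K) C c).
  { repeat split; auto. apply rem_hewitt_closed; auto. }
  exists (collapse K (cl_rem_hewitt K) C c).
  split; [apply collapse_in_U; auto|]. intros p q. apply collapse_rel; auto.
Qed.

Lemma realize_add {X : space} (K : extension X) p0 (C : ext_sp K -> Prop) c :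
  setting K -> ~ base K p0 -> closed C ->
  (forall q, C q -> cl_rem_hewitt K q \/ q = p0) -> C c ->
  exists E, in_U X E /\ forall p q, rel K E p q <->
    (p = q /\ (base K p \/ p = p0)) \/ (C p /\ C q).
Proof.
  intros HS Np HC CH Cc. destruct HS as [h1 h2 h3 h4].
  assert (HT := proj1 (proj1 h2)).
  assert (G : collapsible K (fun q => cl_rem_hewitt K q \/ q = p0) C c).
  { repeat split; auto.
    - apply closed_or; [apply HT|apply rem_hewitt_closed; auto|].
      apply closed_point; apply HT.
    - intros q [h|h]; auto. subst q. intro i; apply Np; left; auto. }
  exists (collapse K (fun q => cl_rem_hewitt K q \/ q = p0) C c).
  split; [apply collapse_in_U; auto|]. intros p q.
  rewrite collapse_rel; auto. unfold base. tauto.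
Qed.

(** Shrinking a single point [o] changes nothing, so equality on [base K] is realized by an element
    of [U(X)], and it is contained in every other relation. *)
Lemma top_rel {X : space} (K E : extension X) : setting K -> in_U X E ->
  (is_top (in_U X) ext_le E <-> forall p q, rel K E p q -> p = q /\ base K p).
Proof.
  intros HS HE. pose proof HS as [h1 h2 h3 [o Ho]].
  pose proof (proj1 (proj1 h2)) as HT. split.
  - intros [_ T]. destruct (realize_base K (fun q => q = o) o HS) as [M [HM EM]]; auto.
    { apply closed_point; apply HT. }
    { intros; subst; auto. }
    intros p q Hr. apply (in_U_le K M E HS HM HE) in Hr; auto.
    apply EM in Hr. destruct Hr as [H|[H1 H2]]; auto. subst. split; auto. right; auto.
  - intros H. split; auto. intros E' HE'. apply (in_U_le K); auto. intros p q Hr.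
    apply H in Hr. destruct Hr as [e Hb]. subst. apply base_refl; auto.
Qed.

Lemma coatom_add {X : space} (K E : extension X) p0 : setting K -> in_U X E ->
  ~ base K p0 -> (forall p q, rel K E p q <-> p = q /\ (base K p \/ p = p0)) ->
  is_coatom (in_U X) ext_le E.
Proof.
  intros HS HE Np HR. split; auto. split.
  - intro T. apply (top_rel K E HS HE) with (p := p0) (q := p0) in T; [tauto|].
    apply HR; auto.
  - intros E' HE' L. rewrite (in_U_le K E E') in L; auto.
    destruct (classic (rel K E' p0 p0)) as [Hr|Nr].
    + left. apply (in_U_le K); auto. intros p q Hpq. apply HR in Hpq.
      destruct Hpq as [e [Hb|Hb]]; subst; auto. apply base_refl; auto.
    + right. apply (top_rel K); auto. intros p q Hpq. pose proof Hpq as Hpq'.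
      apply L, HR in Hpq. destruct Hpq as [e [Hb|Hb]]; subst; tauto.
Qed.

Definition is_pair {X : space} (K E : extension X) a b : Prop :=
  in_U X E /\ cl_rem_hewitt K a /\ cl_rem_hewitt K b /\ a <> b /\
  forall p q, rel K E p q <->
    (p = q /\ base K p) \/ ((p = a \/ p = b) /\ (q = a \/ q = b)).

Lemma exists_pair {X : space} (K : extension X) a b : setting K ->
  cl_rem_hewitt K a -> cl_rem_hewitt K b -> a <> b -> exists E, is_pair K E a b.
Proof.
  intros HS Ha Hb Nab. pose proof HS as [h1 h2 h3 _].
  pose proof (proj1 (proj1 h2)) as HT.
  destruct (realize_base K (fun q => q = a \/ q = b) a HS) as [E [HE ER]]; auto.
  - apply closed_pair; apply HT.
  - intros q [h|h]; subst; auto.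
  - exists E. split; [|split; [|split; [|split]]]; auto.
Qed.

(** The diagonal of [base K] lies in every relation, so only the pair itself has to be tested. This
    turns the identification of two points into an order statement. *)
Lemma le_pair {X : space} (K E P : extension X) a b :
  setting K -> in_U X E -> is_pair K P a b -> (ext_le E P <-> rel K E a b).
Proof.
  intros HS HE [HP [Ha [Hb [Nab HR]]]].
  rewrite (in_U_le K); auto. split.
  - intros H. apply H, HR. auto.
  - intros H p q Hr. apply HR in Hr.
    destruct Hr as [[e Hp]|[[e1|e1] [e2|e2]]]; subst; auto;
      try (apply base_refl; auto; right; auto; fail). apply rel_sym; auto.
Qed.

Lemma pair_coatom {X : space} (K P : extension X) a b :
  setting K -> is_pair K P a b -> is_coatom (in_U X) ext_le P.
Proof.
  intros HS HPp. pose proof HPp as [HP [Ha [Hb [Nab HR]]]]. split; auto. split.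
  - intro T. apply (top_rel K P HS HP) with (p := a) (q := b) in T; [tauto|].
    apply HR; auto.
  - intros E HE L. rewrite (in_U_le K P E) in L; auto.
    destruct (classic (rel K E a b)) as [Hr|Nr].
    + left. apply (le_pair K E P a b); auto.
    + right. apply (top_rel K); auto. intros p q Hpq. pose proof Hpq as Hpq'.
      apply L, HR in Hpq.
      destruct Hpq as [[e Hp]|[[e1|e1] [e2|e2]]]; subst; auto.
      * split; auto. right; auto.
      * tauto.
      * apply rel_sym in Hpq'; tauto.
      * split; auto. right; auto.
Qed.

Lemma add_above {X : space} (K E : extension X) p0 : setting K -> in_U X E ->
  ~ base K p0 -> rel K E p0 p0 ->
  exists A, in_U X A /\ ext_le E A /\
    forall p q, rel K A p q <-> p = q /\ (base K p \/ p = p0).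
Proof.
  intros HS HE Np Hr. pose proof HS as [h1 h2 h3 [o Ho]].
  pose proof (proj1 (proj1 h2)) as HT.
  destruct (realize_add K p0 (fun q => q = p0) p0 HS) as [A [HA RA]]; auto.
  { apply closed_point; apply HT. }
  assert (RA' : forall p q, rel K A p q <-> p = q /\ (base K p \/ p = p0)).
  { intros p q; rewrite RA. split; [|tauto]. intros [H|[e1 e2]]; subst; tauto. }
  exists A. split; auto. split; auto.
  apply (in_U_le K); auto. intros p q Hpq. apply RA' in Hpq.
  destruct Hpq as [e [Hb|Hb]]; subst; auto. apply base_refl; auto.
Qed.

(** Points of [X] are related only to themselves, so such a pair avoids [X]. The outcomes are the
    two sources of coatoms above [E]: an added point, or two distinct points of the closure. *)
Lemma rel_base_cases {X : space} (K E : extension X) p q :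
  setting K -> in_U X E -> rel K E p q -> ~ (p = q /\ base K p) ->
  (~ base K p /\ rel K E p p) \/ (~ base K q /\ rel K E q q) \/
  (cl_rem_hewitt K p /\ cl_rem_hewitt K q /\ p <> q).
Proof.
  intros HS HE Hr N.
  assert (Hp : rel K E p p).
  { eapply rel_trans; [apply HS|apply HE|exact Hr|apply rel_sym; auto]. }
  assert (Hq : rel K E q q).
  { eapply rel_trans; [apply HS|apply HE|apply rel_sym; exact Hr|auto]. }
  assert (Ni : ~ (image_of K p \/ image_of K q)).
  { intro i. pose proof (in_U_rel_image K E p q HS HE i Hr). subst q.
    apply N. split; auto. left; tauto. }
  unfold base in *. destruct (classic (cl_rem_hewitt K p)); [|tauto].
  destruct (classic (cl_rem_hewitt K q)); [|tauto].
  right; right. repeat split; auto.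
Qed.

Lemma pair_pairlike {X : space} (K P : extension X) a b :
  setting K -> is_pair K P a b -> is_pairlike (in_U X) ext_le P.
Proof.
  intros HS HPp. split; [eapply pair_coatom; eauto|].
  pose proof HPp as [HP [Ha [Hb [Nab HR]]]].
  intros E HE L. apply (le_pair K E P a b HS HE HPp) in L.
  destruct (classic (ext_le P E)) as [L'|N]; auto. right.
  assert (Hadd : forall p0, ~ base K p0 -> rel K E p0 p0 ->
    exists c', is_coatom (in_U X) ext_le c' /\ ext_le E c' /\ ~ ext_le c' P).
  { intros p0 Np Hr. destruct (add_above K E p0 HS HE Np Hr) as [A [HA [LA RA]]].
    exists A. split; [eapply coatom_add; eauto|]. split; auto.
    intro L'. apply (le_pair K A P a b HS HA HPp) in L'. apply RA in L'. tauto. }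
  rewrite (in_U_le K) in N; auto.
  apply not_all_ex_not in N. destruct N as [p N].
  apply not_all_ex_not in N. destruct N as [q N].
  apply imply_to_and in N. destruct N as [Hr N]. rewrite HR in N.
  destruct (rel_base_cases K E p q HS HE Hr) as [[Np Hp]|[[Nq Hq]|[Hp [Hq Npq]]]]; eauto.
  destruct (exists_pair K p q HS Hp Hq Npq) as [A HA].
  exists A. split; [eapply pair_coatom; eauto|]. split.
  - apply (le_pair K E A p q); auto.
  - intro L'. apply (le_pair K A P a b HS (proj1 HA) HPp) in L'.
    apply (proj2 (proj2 (proj2 (proj2 HA)))) in L'.
    destruct L' as [[e _]|[[e1|e1] [e2|e2]]]; subst; tauto.
Qed.

Lemma pairlike_pair {X : space} (K P : extension X) :
  setting K -> is_pairlike (in_U X) ext_le P -> exists a b, is_pair K P a b.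
Proof.
  intros HS [[HP [NT Hc]] Hl]. pose proof HS as [h1 h2 h3 [o Ho]].
  pose proof (proj1 (proj1 h2)) as HT.
  assert (Hadd : forall p0, ~ base K p0 -> rel K P p0 p0 -> False).
  { intros p0 Np Hr. destruct (add_above K P p0 HS HP Np Hr) as [A [HA [LA RA]]].
    assert (L : ext_le A P).
    { destruct (Hc A HA LA) as [L|T]; auto. exfalso.
      apply (proj1 (proj2 (coatom_add K A p0 HS HA Np RA))); auto. }
    rewrite (in_U_le K A P) in L; auto.
    (* The test element identifies the added point [p0] with [o]. A coatom above it but not below
       [P] cannot have [p0] in its domain; nothing is then left of the identification, and it would
       be the top. *)
    destruct (realize_add K p0 (fun q => q = p0 \/ q = o) p0 HS) as [E [HE RE]]; auto.
    { apply closed_pair; apply HT. }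
    { intros q [e|e]; subst; auto. }
    destruct (Hl E HE) as [L'|[c' [Cc' [L1 L2]]]].
    - apply (in_U_le K); auto. intros p q Hpq. apply L, RA in Hpq. apply RE; auto.
    - rewrite (in_U_le K) in L'; auto.
      assert (H : rel K P p0 o) by (apply L', RE; auto).
      apply L, RA in H. destruct H as [e _]. subst. apply Np; right; auto.
    - apply (proj1 (proj2 Cc')). apply (top_rel K c' HS (proj1 Cc')).
      rewrite (in_U_le K E c' HS HE (proj1 Cc')) in L1.
      assert (N0 : ~ rel K c' p0 p0).
      { intro h. apply L2. apply (in_U_le K c' P HS (proj1 Cc') HP).
        intros p q Hpq. apply L, RA in Hpq.
        destruct Hpq as [e [Hb|Hb]]; subst; auto. apply base_refl; auto; apply Cc'. }
      intros p q Hpq.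
      assert (Hpp : rel K c' p p).
      { eapply rel_trans; [apply HS|apply (proj1 Cc')|exact Hpq|apply rel_sym; auto]. }
      assert (Hqq : rel K c' q q).
      { eapply rel_trans; [apply HS|apply (proj1 Cc')|apply rel_sym; exact Hpq|auto]. }
      apply L1, RE in Hpq.
      destruct Hpq as [[e [Hb|Hb]]|[[e1|e1] [e2|e2]]]; subst; try tauto.
      split; auto. right; auto. }
  assert (N : ~ forall p q, rel K P p q -> p = q /\ base K p).
  { intro H. apply NT, (top_rel K); auto. }
  apply not_all_ex_not in N. destruct N as [a N].
  apply not_all_ex_not in N. destruct N as [b N].
  apply imply_to_and in N. destruct N as [Hr N].
  destruct (rel_base_cases K P a b HS HP Hr N) as [[Np Hp]|[[Nq Hq]|[Ha [Hb Nab]]]];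
    [exfalso; eauto|exfalso; eauto|].
  destruct (exists_pair K a b HS Ha Hb Nab) as [A HA].
  assert (LA : ext_le P A) by (apply (le_pair K P A a b); auto).
  assert (L : ext_le A P).
  { destruct (Hc A (proj1 HA) LA) as [L|T]; auto. exfalso.
    apply (proj1 (proj2 (pair_coatom K A a b HS HA))); auto. }
  rewrite (in_U_le K) in L, LA; auto; try apply HA.
  exists a, b. split; [|split; [|split; [|split]]]; auto.
  intros p q. rewrite <- (proj2 (proj2 (proj2 (proj2 HA)))). split; auto.
Qed.

(** * Recovering the points from the pairs *)

(** Abstracts the relations of the elements of [U(X)], restricted to the closure: equivalences with
    closed classes, including every one that collapses a single closed set. *)
Record class_system {S : space} {I : Type} (r : I -> S -> S -> Prop) : Prop := ClassSystem {
  cs_top : is_topology S;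
  cs_haus : Hausdorff S;
  cs_refl : forall i p, r i p p;
  cs_sym : forall i p q, r i p q -> r i q p;
  cs_trans : forall i p q s, r i p q -> r i q s -> r i p s;
  cs_closed : forall i p, closed (fun q => r i q p);
  cs_collapse : forall C c, closed C -> C c ->
    exists i, forall p q, r i p q <-> p = q \/ (C p /\ C q) }.

(** A correspondence of edges of the complete graphs on [S] and [T]; the ends of an edge may be
    exchanged. *)
Definition matched {S T : space} {I : Type} (rS : I -> S -> S -> Prop)
    (rT : I -> T -> T -> Prop) (a b : S) (s t : T) : Prop :=
  a <> b /\ s <> t /\ forall i, rS i a b <-> rT i s t.

Definition linked {S T : space} {I : Type} (rS : I -> S -> S -> Prop)
    (rT : I -> T -> T -> Prop) : Prop :=
  class_system rS /\ class_system rT /\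
  (forall a b, a <> b -> exists s t, matched rS rT a b s t) /\
  (forall s t, s <> t -> exists a b, matched rS rT a b s t).

Section Linked.
Context {S T : space} {I : Type} {rS : I -> S -> S -> Prop} {rT : I -> T -> T -> Prop}.

Lemma matched_flip a b s t : matched rS rT a b s t -> matched rT rS s t a b.
Proof. intros [H1 [H2 H3]]. split; [|split]; auto. intros i; symmetry; auto. Qed.

Lemma matched_swap_l a b s t :
  class_system rS -> matched rS rT a b s t -> matched rS rT b a s t.
Proof.
  intros HS [H1 [H2 H3]]. split; [|split]; auto.
  intros i; rewrite <- H3. split; apply (cs_sym _ HS).
Qed.

Lemma matched_swap_r a b s t :
  class_system rT -> matched rS rT a b s t -> matched rS rT a b t s.
Proof.
  intros HT [H1 [H2 H3]]. split; [|split]; auto.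
  intros i; rewrite H3. split; apply (cs_sym _ HT).
Qed.

(** The index collapsing exactly [s] and [t] must also identify [s'] and [t']. *)
Lemma matched_unique a b s t s' t' : class_system rT ->
  matched rS rT a b s t -> matched rS rT a b s' t' ->
  (s' = s /\ t' = t) \/ (s' = t /\ t' = s).
Proof.
  intros HT [_ [N H]] [_ [N' H']].
  destruct (cs_collapse _ HT (fun z => z = s \/ z = t) s) as [i Hi]; auto.
  { apply closed_pair; apply HT. }
  assert (h : rT i s' t') by (apply H', H, Hi; auto).
  apply Hi in h. destruct h as [h|[[e1|e1] [e2|e2]]]; subst; tauto.
Qed.

Lemma matched_injective a b a' b' s t : class_system rS ->
  matched rS rT a b s t -> matched rS rT a' b' s t ->
  (a' = a /\ b' = b) \/ (a' = b /\ b' = a).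
Proof.
  intros HS [N [_ H]] [N' [_ H']].
  destruct (cs_collapse _ HS (fun z => z = a \/ z = b) a) as [i Hi]; auto.
  { apply closed_pair; apply HS. }
  assert (h : rS i a' b') by (apply H', H, Hi; auto).
  apply Hi in h. destruct h as [h|[[e1|e1] [e2|e2]]]; subst; tauto.
Qed.

(** Edges with a common end have images with a common end. Suppose those of [ab] and [ac] are
    disjoint. Collapsing the images of [ac] and [bc] identifies [a], [b], [c], so the image of [ab]
    must be that of [bc]. Collapsing the images of [ab] and [bc] then forces the image of [ac] to
    meet them, a contradiction. *)
Lemma matched_share a b c s t s' t' s'' t'' : class_system rS -> class_system rT ->
  matched rS rT a b s t -> matched rS rT a c s' t' -> matched rS rT b c s'' t'' ->
  (s = s' \/ s = t') \/ (t = s' \/ t = t').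
Proof.
  intros HS HT [Nab [Nst H]] [Nac [Nst' H']] [Nbc [Nst'' H'']].
  apply NNPP; intro D.
  assert (D1 : s <> s') by tauto. assert (D2 : s <> t') by tauto.
  assert (D3 : t <> s') by tauto. assert (D4 : t <> t') by tauto. clear D.
  assert (clT : forall u v w z : T, closed (fun q => (q = u \/ q = v) \/ (q = w \/ q = z))).
  { intros. apply closed_or; try apply closed_pair; apply HT. }
  destruct (cs_collapse _ HT _ s' (clT s' t' s'' t'')) as [j Hj]; auto.
  destruct (cs_collapse _ HT _ s (clT s t s'' t'')) as [k Hk]; auto.
  assert (B : rT j s t).
  { apply H. apply (cs_trans _ HS) with c.
    - apply H', Hj; auto.
    - apply (cs_sym _ HS), H'', Hj; auto. }
  assert (E : rT k s' t').
  { apply H'. apply (cs_trans _ HS) with b.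
    - apply H, Hk; auto.
    - apply H'', Hk; auto. }
  apply Hj in B. apply Hk in E. clear - B E D1 D2 D3 D4 Nst Nst'.
  destruct B as [B|[[[?|?]|B1] [[?|?]|B2]]]; try contradiction.
  destruct E as [E|[[[?|?]|E1] _]]; try contradiction; try congruence.
  destruct B1, B2, E1; congruence.
Qed.

Lemma matched_triangle a b c : linked rS rT -> a <> b -> a <> c -> b <> c ->
  exists u v w, u <> v /\ u <> w /\ v <> w /\
    matched rS rT a b u v /\ matched rS rT a c u w /\ matched rS rT b c v w.
Proof.
  intros [HS [HT [tS tT]]] Nab Nac Nbc.
  destruct (tS a b Nab) as [s [t M]], (tS a c Nac) as [s' [t' M']],
    (tS b c Nbc) as [s'' [t'' M'']].
  assert (exists u v w, matched rS rT a b u v /\ matched rS rT a c u w)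
    as [u [v [w [A B]]]].
  { destruct (matched_share _ _ _ _ _ _ _ _ _ HS HT M M' M'') as [[e|e]|[e|e]]; subst.
    - exists s', t, t'; auto.
    - exists t', t, s'; split; auto. apply matched_swap_r; auto.
    - exists s', s, t'; split; auto. apply matched_swap_r; auto.
    - exists t', s, s'; split; apply matched_swap_r; auto. }
  assert (Nvw : v <> w).
  { intro e; subst w. destruct (matched_injective _ _ _ _ _ _ HS A B); intuition congruence. }
  (* Collapsing [u], [v], [w] identifies [a], [b], [c], so the image of [bc] lies among these three
     points; injectivity excludes [uv] and [uw], hence a star in place of a triangle. *)
  destruct (cs_collapse _ HT (fun z => (z = u \/ z = v) \/ z = w) u) as [i Hi]; auto.
  { apply closed_or; [apply HT|apply closed_pair; apply HT|apply closed_point; apply HT]. }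
  assert (h : rT i s'' t'').
  { apply M''. apply (cs_trans _ HS) with a.
    - apply (cs_sym _ HS), A, Hi; auto.
    - apply B, Hi; auto. }
  exists u, v, w. split; [apply A|]. split; [apply B|]. split; auto. split; auto.
  split; auto.
  assert (N1 : ~ matched rS rT b c u v).
  { intro h1. destruct (matched_injective _ _ _ _ _ _ HS A h1); intuition congruence. }
  assert (N2 : ~ matched rS rT b c u w).
  { intro h1. destruct (matched_injective _ _ _ _ _ _ HS B h1); intuition congruence. }
  pose proof (matched_swap_r _ _ _ _ HT M'') as M2.
  pose proof (proj1 (proj2 M'')) as N''.
  apply Hi in h. destruct h as [h|[[[e1|e1]|e1] [[e2|e2]|e2]]]; subst; tauto.
Qed.

Definition point_image (a : S) (t : T) : Prop :=
  forall b s s', matched rS rT a b s s' -> t = s \/ t = s'.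

(** The image of an edge at [a] meets both [uv] and [uw]. If it avoided [u] it would be [vw], which
    is already the image of [bc]. *)
Lemma point_image_exists a b c : linked rS rT -> a <> b -> a <> c -> b <> c ->
  exists t, point_image a t.
Proof.
  intros HL Nab Nac Nbc. pose proof HL as [HS [HT [tS tT]]].
  destruct (matched_triangle a b c HL Nab Nac Nbc)
    as [u [v [w [Nuv [Nuw [Nvw [A [B D]]]]]]]].
  exists u. intros d s s' M.
  destruct (classic (d = b)) as [e|Ndb].
  { subst d. destruct (matched_unique _ _ _ _ _ _ HT A M); intuition congruence. }
  destruct (classic (d = c)) as [e|Ndc].
  { subst d. destruct (matched_unique _ _ _ _ _ _ HT B M); intuition congruence. }
  pose proof (proj1 M) as Nad.
  destruct (tS d b Ndb) as [x [x' Mx]], (tS d c Ndc) as [y [y' My]].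
  pose proof (matched_share _ _ _ _ _ _ _ _ _ HS HT M A Mx) as h1.
  pose proof (matched_share _ _ _ _ _ _ _ _ _ HS HT M B My) as h2.
  apply NNPP; intro N. apply not_or_and in N. destruct N as [N1 N2].
  pose proof (proj1 (proj2 M)) as N3.
  assert (M' : matched rS rT a d v w).
  { assert ((s = v /\ s' = w) \/ (s = w /\ s' = v)) as [[e1 e2]|[e1 e2]].
    - assert (s = v \/ s' = v) by (intuition congruence).
      assert (s = w \/ s' = w) by (intuition congruence).
      intuition congruence.
    - subst; auto.
    - subst; apply matched_swap_r; auto. }
  destruct (matched_injective _ _ _ _ _ _ HS D M'); intuition congruence.
Qed.

(** A third point [c] pins down both images: [u] is the only common end of [uv] and [uw], and [v]
    that of [uv] and [vw]. *)
Lemma point_image_matched a b s t : linked rS rT ->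
  (exists x y z : S, x <> y /\ x <> z /\ y <> z) -> a <> b ->
  point_image a s -> point_image b t -> matched rS rT a b s t.
Proof.
  intros HL [x [y [z [Nxy [Nxz Nyz]]]]] Nab Ha Hb. pose proof HL as [HS [HT [tS tT]]].
  assert (exists c, a <> c /\ b <> c) as [c [Nac Nbc]].
  { destruct (classic (a <> x /\ b <> x)) as [h|h]; [exists x; auto|].
    destruct (classic (a <> y /\ b <> y)) as [h'|h']; [exists y; auto|].
    exists z.
    destruct (classic (a = x)), (classic (b = x)), (classic (a = y)), (classic (b = y));
      subst; intuition congruence. }
  destruct (matched_triangle a b c HL Nab Nac Nbc)
    as [u [v [w [Nuv [Nuw [Nvw [A [B D]]]]]]]].
  assert (s = u).
  { destruct (Ha _ _ _ A), (Ha _ _ _ B); subst; auto; tauto. }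
  assert (t = v).
  { destruct (Hb _ _ _ (matched_swap_l _ _ _ _ HS A)), (Hb _ _ _ D); subst; auto; tauto. }
  subst; auto.
Qed.

(** A nonempty closed set of [T] is a class of some index, and its preimage is a class of the same
    index in [S], hence closed. *)
Lemma matched_bijection_continuous (F : S -> T) (G : T -> S) : linked rS rT ->
  (forall a, G (F a) = a) -> (forall t, F (G t) = t) ->
  (forall a b, a <> b -> matched rS rT a b (F a) (F b)) -> continuous F.
Proof.
  intros [HS [HT _]] GF FG HM V HV.
  destruct (classic (exists t, ~ V t)) as [[t Nt]|N].
  - destruct (cs_collapse _ HT (fun z => ~ V z) t) as [i Hi]; auto.
    { unfold closed. apply (op_ext V); auto. intros z; split; [auto|apply NNPP]. }
    apply (op_ext (fun a => ~ rS i a (G t))); [|apply (cs_closed _ HS)].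
    intros a. destruct (classic (a = G t)) as [e|Na].
    + subst a. rewrite FG. split; [|tauto]. intro h; exfalso; apply h, (cs_refl _ HS).
    + destruct (HM a (G t) Na) as [_ [Nf h]]. rewrite h, Hi. rewrite FG in *.
      split; [|tauto]. intro h'. apply NNPP; intro NV. apply h'. right; auto.
  - apply (op_ext (fun _ => True)); [|apply HS].
    intros a; split; auto. intros _. apply NNPP; intro NV. apply N. eauto.
Qed.

End Linked.

Lemma linked_flip {S T : space} {I : Type} (rS : I -> S -> S -> Prop)
    (rT : I -> T -> T -> Prop) : linked rS rT -> linked rT rS.
Proof.
  intros [HS [HT [tS tT]]]. split; [|split; [|split]]; auto.
  - intros s t N. destruct (tT s t N) as [a [b M]]. exists a, b. apply matched_flip; auto.
  - intros a b N. destruct (tS a b N) as [s [t M]]. exists s, t. apply matched_flip; auto.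
Qed.

Lemma matched_bijection_homeomorphic {S T : space} {I : Type}
    (rS : I -> S -> S -> Prop) (rT : I -> T -> T -> Prop) (F : S -> T) (G : T -> S) :
  linked rS rT -> (forall a, G (F a) = a) -> (forall t, F (G t) = t) ->
  (forall a b, a <> b -> matched rS rT a b (F a) (F b)) -> homeomorphic S T.
Proof.
  intros HL GF FG HM. exists F, G. split; [|split; [|split]]; auto.
  - eapply matched_bijection_continuous; eauto.
  - apply (@matched_bijection_continuous T S I rT rS G F); auto.
    { apply linked_flip; auto. }
    intros s t N. apply matched_flip.
    assert (N' : G s <> G t) by (intro e; apply N; rewrite <- (FG s), <- (FG t), e; auto).
    pose proof (HM _ _ N') as M. rewrite !FG in M. exact M.
Qed.

Definition three_points (S : Type) : Prop := exists x y z : S, x <> y /\ x <> z /\ y <> z.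

Lemma three_others {S : Type} (a : S) : three_points S ->
  exists b c, a <> b /\ a <> c /\ b <> c.
Proof.
  intros [x [y [z [Nxy [Nxz Nyz]]]]].
  destruct (classic (a = x)); [subst; exists y, z; auto|].
  destruct (classic (a = y)); [subst; exists x, z; auto|].
  exists x, y; auto.
Qed.

Lemma linked_point_map {S T : space} {I : Type} (rS : I -> S -> S -> Prop)
    (rT : I -> T -> T -> Prop) : linked rS rT -> three_points S ->
  exists F : S -> T, forall a b, a <> b -> matched rS rT a b (F a) (F b).
Proof.
  intros HL H3.
  assert (H : forall a : S, exists t : T, @point_image S T I rS rT a t).
  { intros a. destruct (three_others a H3) as [b [c [N1 [N2 N3]]]].
    apply (point_image_exists a b c); auto. }
  exists (fun a => proj1_sig (constructive_indefinite_description _ (H a))).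
  intros a b N. apply point_image_matched; auto;
    destruct (constructive_indefinite_description _ _); auto.
Qed.

Lemma linked_three {S T : space} {I : Type} (rS : I -> S -> S -> Prop)
    (rT : I -> T -> T -> Prop) : linked rS rT -> three_points S -> three_points T.
Proof.
  intros HL [x [y [z [N1 [N2 N3]]]]].
  destruct (matched_triangle x y z HL N1 N2 N3) as [u [v [w [h1 [h2 [h3 _]]]]]].
  exists u, v, w; auto.
Qed.

(** [G (F a)] lies in every pair containing [a], and two such pairs have only [a] in common. *)
Lemma linked_retract {S T : space} {I : Type} (rS : I -> S -> S -> Prop)
    (rT : I -> T -> T -> Prop) (F : S -> T) (G : T -> S) :
  linked rS rT -> three_points S ->
  (forall a b, a <> b -> matched rS rT a b (F a) (F b)) ->
  (forall s t, s <> t -> matched rT rS s t (G s) (G t)) -> forall a, G (F a) = a.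
Proof.
  intros [HS _] H3 HF HG a.
  destruct (three_others a H3) as [b [c [N1 [N2 N3]]]].
  assert (G1 : forall d, a <> d -> G (F a) = a \/ G (F a) = d).
  { intros d N. pose proof (HF a d N) as M.
    pose proof (HG _ _ (proj1 (proj2 M))) as M'. apply matched_flip in M.
    destruct (matched_unique _ _ _ _ _ _ HS M M'); tauto. }
  destruct (G1 b N1), (G1 c N2); congruence.
Qed.

(* Two points are too few for the incidence argument to single out the image of
   a point, so that case is treated apart. *)
Lemma linked_homeomorphic {S T : space} {I : Type} (rS : I -> S -> S -> Prop)
    (rT : I -> T -> T -> Prop) (s0 : S) (t0 : T) : linked rS rT -> homeomorphic S T.
Proof.
  intros HL. pose proof (linked_flip _ _ HL) as HL'.
  pose proof HL as [HS [HT [tS tT]]].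
  destruct (classic (three_points S)) as [H3|N3].
  - pose proof (linked_three _ _ HL H3) as H3'.
    destruct (linked_point_map _ _ HL H3) as [F HF].
    destruct (linked_point_map _ _ HL' H3') as [G HG].
    apply (matched_bijection_homeomorphic rS rT F G); auto.
    + apply (linked_retract rS rT); auto.
    + apply (linked_retract rT rS); auto.
  - assert (N3' : ~ three_points T) by (intro h; apply N3, (linked_three _ _ HL' h)).
    destruct (classic (exists a : S, a <> s0)) as [[a Na]|N].
    + destruct (tS a s0 Na) as [s [t M]]. pose proof (proj1 (proj2 M)) as Nst.
      assert (ES : forall x, x = a \/ x = s0).
      { intros x. apply NNPP; intro h. apply N3. exists x, a, s0. tauto. }
      assert (ET : forall x, x = s \/ x = t).
      { intros x. apply NNPP; intro h. apply N3'. exists x, s, t. tauto. }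
      (* With exactly two points on each side, any bijection carries the only pair to the only
         pair. *)
      pose (F := fun x => if excluded_middle_informative (x = a) then s else t).
      pose (G := fun x => if excluded_middle_informative (x = s) then a else s0).
      assert (Fa : F a = s) by (unfold F; destruct (excluded_middle_informative _); tauto).
      assert (Fs : F s0 = t)
        by (unfold F; destruct (excluded_middle_informative _); [congruence|auto]).
      assert (Gs : G s = a) by (unfold G; destruct (excluded_middle_informative _); tauto).
      assert (Gt : G t = s0)
        by (unfold G; destruct (excluded_middle_informative _); [congruence|auto]).
      apply (matched_bijection_homeomorphic rS rT F G); auto.
      * intros x. destruct (ES x); subst x; congruence.
      * intros x. destruct (ET x); subst x; congruence.
      * intros x y Nxy. destruct (ES x), (ES y); subst x y; try tauto; rewrite Fa, Fs; auto.
        apply matched_swap_l, matched_swap_r; auto.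
    + assert (ES : forall x, x = s0).
      { intros x. apply NNPP; intro h. apply N; exists x; auto. }
      assert (ET : forall x, x = t0).
      { intros x. apply NNPP; intro h. destruct (tT x t0 h) as [a [b [M _]]].
        apply M. rewrite (ES a), (ES b); auto. }
      apply (matched_bijection_homeomorphic rS rT (fun _ => t0) (fun _ => s0)); auto.
      intros a b h. exfalso; apply h. rewrite (ES a), (ES b); auto.
Qed.

(** * From the order-isomorphism to linked class systems *)

Lemma class_system_rel {X : space} (K : extension X) {I : Type} (f : I -> extension X) :
  setting K -> (forall i, in_U X (f i)) -> (forall E, in_U X E -> exists i, f i = E) ->
  class_system (fun i (p q : subspace (ext_sp K) (cl_rem_hewitt K)) =>
                  rel K (f i) (proj1_sig p) (proj1_sig q)).
Proof.
  intros HS HU Hf. pose proof HS as [h1 h2 h3 _].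
  pose proof (proj1 (proj1 h2)) as HT. split.
  - apply subspace_topology, HT.
  - apply subspace_Hausdorff, HT.
  - intros i p. apply base_refl; auto. right. apply (proj2_sig p).
  - intros i p q. apply rel_sym.
  - intros i p q s. apply rel_trans; auto. apply HU.
  - intros i p. exists (fun q => ~ rel K (f i) q (proj1_sig p)). split; [|tauto].
    apply rel_class_closed; auto. apply HU.
  - intros C c HC Cc.
    destruct (realize_base K (fun q => exists h, C (exist _ q h)) (proj1_sig c) HS)
      as [E [HE RE]].
    + apply closed_subspace_image; auto; [apply HT|apply rem_hewitt_closed; auto].
    + intros q [h _]; exact h.
    + exists (proj2_sig c). destruct c; exact Cc.
    + destruct (Hf E HE) as [i Ei]. exists i. intros p q. rewrite Ei, RE.
      destruct p as [p hp], q as [q hq]; simpl. split.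
      * intros [[e _]|[[h Cp] [h' Cq]]].
        -- left. apply sig_ext; auto.
        -- right. rewrite (proof_irrelevance _ hp h), (proof_irrelevance _ hq h'); auto.
      * intros [e|[Cp Cq]].
        -- left. split; [exact (f_equal (@proj1_sig _ _) e)|right; auto].
        -- right. split; [exists hp|exists hq]; auto.
Qed.

(** The coatom identifying [a] and [b] corresponds to a pairlike element for [Y], hence to a pair
    there; [le_pair] translates identification into order on both sides. *)
Lemma matched_pairs {X Y : space} (KX : extension X) (KY : extension Y)
    (R : extension X -> extension Y -> Prop) :
  setting KX -> setting KY -> order_corr (in_U X) ext_le (in_U Y) ext_le R ->
  forall a b : subspace (ext_sp KX) (cl_rem_hewitt KX), a <> b ->
  exists s t : subspace (ext_sp KY) (cl_rem_hewitt KY), s <> t /\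
    forall A B, R A B -> (rel KX A (proj1_sig a) (proj1_sig b) <->
                          rel KY B (proj1_sig s) (proj1_sig t)).
Proof.
  intros HX HY HR a b N. pose proof HR as [H1 [H2 [H3 H4]]].
  destruct (exists_pair KX (proj1_sig a) (proj1_sig b) HX) as [P HP].
  { apply (proj2_sig a). } { apply (proj2_sig b). }
  { intro e; apply N, sig_ext, e. }
  destruct (H2 P (proj1 HP)) as [Q RPQ].
  destruct (pairlike_pair KY Q HY) as [s [t HQ]].
  { eapply order_corr_pairlike; eauto. eapply pair_pairlike; eauto. }
  pose proof HQ as [_ [Hs [Ht [Nst _]]]].
  exists (exist _ s Hs), (exist _ t Ht). split.
  { intro e. apply Nst. exact (f_equal (@proj1_sig _ _) e). }
  intros A B RAB. simpl. destruct (H1 A B RAB) as [HA HB].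
  rewrite <- (le_pair KX A P); eauto. rewrite <- (le_pair KY B Q); eauto.
Qed.

Theorem theorem2p20 :
  forall X Y : space,
    Tychonoff X -> Tychonoff Y ->
    locally_pseudocompact X -> locally_pseudocompact Y ->
    ~ pseudocompact X -> ~ pseudocompact Y ->
    U_order_isomorphic X Y ->
    forall (BX : extension X) (BY : extension Y),
      is_stone_cech BX -> is_stone_cech BY ->
      homeomorphic (subspace (ext_sp BX) (cl_rem_hewitt BX))
                   (subspace (ext_sp BY) (cl_rem_hewitt BY)).
Proof.
  intros X Y TX TY LX LY NX NY [R [H1 [H2 [H3 [_ H4]]]]] BX BY SX SY.
  assert (HX : setting BX).
  { split; auto; [apply TX| |apply rem_hewitt_nonempty; auto].
    intros p; apply rem_hewitt_disjoint; auto; apply TX. }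
  assert (HY : setting BY).
  { split; auto; [apply TY| |apply rem_hewitt_nonempty; auto].
    intros p; apply rem_hewitt_disjoint; auto; apply TY. }
  assert (HR : order_corr (in_U X) ext_le (in_U Y) ext_le R)
    by (split; [|split; [|split]]; auto).
  (* Indexing by corresponding pairs of extensions lets one index act on both closures. *)
  pose (I := {AB : extension X * extension Y | R (fst AB) (snd AB)}).
  destruct (set_ne _ HX) as [p Hp], (set_ne _ HY) as [q Hq].
  apply (@linked_homeomorphic (subspace (ext_sp BX) (cl_rem_hewitt BX))
    (subspace (ext_sp BY) (cl_rem_hewitt BY)) I
    (fun i a b => rel BX (fst (proj1_sig i)) (proj1_sig a) (proj1_sig b))
    (fun i s t => rel BY (snd (proj1_sig i)) (proj1_sig s) (proj1_sig t))
    (exist _ p Hp) (exist _ q Hq)).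
  split; [|split; [|split]].
  - apply (class_system_rel BX (fun i : I => fst (proj1_sig i))); auto.
    + intros [[A B] h]; simpl. exact (proj1 (H1 _ _ h)).
    + intros A HA. destruct (H2 A HA) as [B h]. exists (exist _ (A, B) h); auto.
  - apply (class_system_rel BY (fun i : I => snd (proj1_sig i))); auto.
    + intros [[A B] h]; simpl. exact (proj2 (H1 _ _ h)).
    + intros B HB. destruct (H3 B HB) as [A h]. exists (exist _ (A, B) h); auto.
  - intros a b N. destruct (matched_pairs BX BY R HX HY HR a b N) as [s [t [Nst H]]].
    exists s, t. split; [|split]; auto. intros [[A B] h]; simpl. apply H, h.
  - intros s t N.
    destruct (matched_pairs BY BX _ HY HX (order_corr_sym _ _ _ _ _ HR) s t N)
      as [a [b [Nab H]]].
    exists a, b. split; [|split]; auto. intros [[A B] h]; simpl. symmetry. apply H, h.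
Qed.
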